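(* Fix a sequence $\{a_k\}_{k\in\mathbb{Z}}\in\ell^2(\mathbb{Z})$. Consider the function $f\in PW_\pi$ given by $$f(x)=\sum_{n\in\mathbb{Z}}a_n\,\mathrm{sinc}(x-n)$$ for each $x\in\mathbb{R}$. Then the interpolation formula $$f(x)=\frac{4\sin^2(\tfrac12\pi x)}{\pi^2}\sum_{k\in\mathbb{Z}}\left\{\frac{a_{2k}}{(x-2k)^2}+\frac{b_{2k}}{x-2k}\right\}$$ holds, where the right-hand side converges uniformly on compact sets, and where $$b_k=\sum_{j\in\mathbb{Z},\,j\ne k}\frac{a_j}{k-j}(-1)^{k-j}.$$
   Context: $\mathrm{sinc}(x)=\frac{\sin(\pi x)}{\pi x}$ (with value $1$ at $x=0$). $PW_\pi$ denotes the space of functions $f\in L^2(\mathbb{R})$ whose Fourier transform $\widehat f(\xi)=\int_{\mathbb{R}}f(x)e^{-2\pi i x\xi}\,dx$ is supported in $[-1/2,1/2]$ (equivalently, of exponential type at most $\pi$). At even integers $x=2k$ each term of the right-hand side, including the factor $\sin^2(\frac12\pi x)$, is interpreted by continuity. *)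

(* Defs.v *)
From HB Require Import structures.
From mathcomp Require Export all_boot all_order all_algebra finmap.
From mathcomp Require Export complex.
From mathcomp Require Export all_classical all_reals all_analysis.
From mathcomp.analysis.showcase Require summability.

Set Implicit Arguments.
Unset Strict Implicit.
Unset Printing Implicit Defensive.

Import Order.TTheory GRing.Theory Num.Theory.
Import numFieldNormedType.Exports.

Local Open Scope classical_set_scope.
Local Open Scope ring_scope.
Local Open Scope complex_scope.

(* Complex numbers are [R[i]]. Its topology (that of the modulus) is only
   found by canonical structure inference on the convertible type [R[i]^o],
   whence the casts to [R[i]^o] wherever a limit is taken. *)

Section Series.
Context {R : realType}.
Implicit Types (u : int -> R[i]) (s : R[i]).

(* A series over Z is summed along the net of finite subsets of Z ordered by
   inclusion: the sum does not depend on an enumeration of Z, and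
   convergence amounts to absolute convergence. *)
Definition has_zsum u s : Prop :=
  summability.partial_sum (u : int -> R[i]^o) @ summability.totally
    --> (s : R[i]^o).

(* Meaningful only if the series converges. *)
Definition zsum u : R[i] := summability.sum (u : int -> R[i]^o).

Definition ell2 u : Prop :=
  summable [set: int] (fun n => (ComplexField.Normc.normc (u n) ^+ 2)%:E).

End Series.

Section PaleyWiener.
Context {R : realType}.
Implicit Types (f g h : R -> R[i]).

Local Notation mu := (@lebesgue_measure R).

Definition cLp (p : \bar R) f : Prop :=
  (@complex.Re R \o f) \in Lfun mu p /\
  (@complex.Im R \o f) \in Lfun mu p.

Definition cdist2 f g : \bar R :=
  'N[mu]_2%:E [EFin \o (fun x => ComplexField.Normc.normc (f x - g x))].

Definition cintegral f : R[i] :=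
  (\int[mu]_x @complex.Re R (f x)) +i* (\int[mu]_x @complex.Im R (f x)).

Definition cis (t : R) : R[i] := cos t +i* sin t.

Definition fourier f (xi : R) : R[i] :=
  cintegral (fun x => f x * cis (- (2 * pi * x * xi))).

(* The Fourier transform on L^2 is the continuous extension of its restriction
   to L^1 `&` L^2: its graph is the closure in L^2 x L^2 of the graph of
   [fourier] on L^1 `&` L^2. *)
Definition is_fourier2 f g : Prop :=
  [/\ cLp 2%:E f, cLp 2%:E g &
    forall eps : R, 0 < eps -> exists h,
      [/\ cLp 1%:E h, cLp 2%:E h,
          (cdist2 f h < eps%:E)%E & (cdist2 g (fourier h) < eps%:E)%E]].

(* [g] is determined by [f] up to a null set only, whence the a.e. *)
Definition PW f : Prop :=
  exists2 g, is_fourier2 f g &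
    {ae mu, forall xi : R, ~ (- 2^-1 <= xi <= 2^-1) -> g xi = 0}.

End PaleyWiener.

Section Interpolation.
Context {R : realType}.
Implicit Types (a : int -> R[i]) (x : R).

Definition sinc x : R := if x == 0 then 1 else sin (pi * x) / (pi * x).

Definition cardinal_term a x (n : int) : R[i] := a n * (sinc (x - n%:~R))%:C.

Definition cardinal_series a x : R[i] := zsum (cardinal_term a x).

Definition b_term a (k j : int) : R[i] :=
  if j == k then 0 else a j / (k - j)%:~R * (-1) ^ (k - j).

Definition b_coef a (k : int) : R[i] := zsum (b_term a k).

Definition interp_raw a (k : int) x : R[i] :=
  (4 * sin (2^-1 * pi * x) ^+ 2 / pi ^+ 2)%:C *
  (a (2 * k) / (x - (2 * k)%:~R)%:C ^+ 2
   + b_coef a (2 * k) / (x - (2 * k)%:~R)%:C).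

(* [g] with its value at [x0] replaced by its limit there. *)
Definition extend_at (x0 : R) (g : R -> R[i]) x : R[i] :=
  if x == x0 then lim ((g : R -> R[i]^o) @ x0^') else g x.

(* At an even integer [x != 2 * k] the formula of [interp_raw] is already
   continuous (with value 0), so the point [2 * k] alone has to be handled. *)
Definition interp_term a (k : int) : R -> R[i] :=
  extend_at (2 * k)%:~R (interp_raw a k).

Definition interp_partial_sum a (A : {fset int}) x : R[i]^o :=
  summability.partial_sum (fun k => interp_term a k x : R[i]^o) A.

End Interpolation.

(* Main.v *)
Require Import Defs.
From mathcomp Require Import measurable_realfun zify ring lra.

(** The coefficient of [a j] in the [k]-th term of the right-hand side is the
    function [interp_coef x k j], and the formula amounts to two facts: for each
    [j] these coefficients sum over [k] to [sinc (x - j)]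
    ([interp_coef_sums]), and the double series over [k] and [j] converges
    absolutely, so that its two iterated sums agree ([sums_fubini]).

    The first fact is a form of the reproducing formula
      [\sum_k sinc (x - k) * sinc (y - k) = sinc (x - y)]
    ([sinc_reproducing]). For odd [j] it is that formula at the points [x / 2]
    and [j / 2]; for even [j] it becomes so after averaging the terms [k] and
    [j - k]. The reproducing formula says that the exponentials with integer
    frequencies are complete in L^2 of [[-1/2, 1/2]]. Integration of
    trigonometric polynomials gives Bessel's inequality ([bessel]). The case
    [x = y], where Bessel's inequality has to be an equality, follows from the
    duplication formula of [sinc] by the argument of Herglotz for the partial
    fractions of the cotangent ([sinc_sqr_sumsE]), and the general case by
    polarization.

    The double series is dominated by [|a j| / (|2 k - j| * |k|)]. With the
    weights [|n| ^ (3/4)] the inequality between arithmetic and geometric means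
    reduces its summability to that of [|n| ^ (-5/4)] ([double_sum_le]). The
    bound is locally uniform in [x], whence the uniform convergence on compact
    sets by the M-test ([interp_uniform]).

    For the membership in the Paley-Wiener space, Bessel's inequality on
    translates of the unit interval bounds the L^2 norm of a partial sum of the
    cardinal series by the l^2 norm of its coefficients
    ([integral_card_sum_le]). The Fourier transform of a partial sum is a
    trigonometric polynomial cut off to [[-1/2, 1/2]], of the same norm
    ([energy_card_hat]); since [sinc] is not integrable, this is proved in the
    sense of closures of graphs, each term being multiplied by
    [expR (- (c * |x - n|))], which makes all the integrals explicit, and [c]
    tending to 0 ([card_sum_approx]). Along a sequence of finite sets with
    geometrically small remainders the transforms converge almost everywhere, and
    Fatou's lemma carries the L^2 bounds over to the limits
    ([PW_cardinal_series]). *)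

Set Implicit Arguments.
Unset Strict Implicit.
Unset Printing Implicit Defensive.

Import Order.TTheory GRing.Theory Num.Theory.
Import numFieldNormedType.Exports.
Local Open Scope classical_set_scope.
Local Open Scope ring_scope.

Notation normc := ComplexField.Normc.normc.

Section Modulus.
Context {R : realType}.
Implicit Types (x y z : R[i]) (r : R).
Local Open Scope complex_scope.

Lemma sqr_normc_Re_Im z : normc z ^+ 2 = complex.Re z ^+ 2 + complex.Im z ^+ 2.
Proof. by case: z => a b /=; rewrite sqr_sqrtr// addr_ge0// sqr_ge0. Qed.

Lemma normc_ge0 z : 0 <= normc z.
Proof. by case: z => a b /=; rewrite sqrtr_ge0. Qed.

Lemma normcD x y : normc (x + y) <= normc x + normc y.
Proof. exact: (@le_normcD R x y). Qed.

Lemma normcB x y : normc (x - y) <= normc x + normc y.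
Proof. by rewrite -[normc y](@normcN R y); exact: normcD. Qed.

Lemma normc_distC x y : normc (x - y) = normc (y - x).
Proof. by rewrite -[normc (y - x)](@normcN R (y - x)) opprB. Qed.

Lemma normc_sum (I : Type) (s : seq I) (P : pred I) (u : I -> R[i]) :
  normc (\sum_(i <- s | P i) u i) <= \sum_(i <- s | P i) normc (u i).
Proof.
elim/big_rec2 : _ => [|i a b _ h]; first by rewrite ComplexField.Normc.normc0.
by apply: (le_trans (normcD _ _)); rewrite lerD2l.
Qed.

Lemma normc_real r : normc r%:C = `|r|.
Proof. by rewrite /= expr0n/= addr0 sqrtr_sqr. Qed.

Lemma normr_Re_le z : `|complex.Re z| <= normc z.
Proof.
by case: z => a b /=; rewrite -sqrtr_sqr ler_wsqrtr// lerDl sqr_ge0.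
Qed.

Lemma normr_Im_le z : `|complex.Im z| <= normc z.
Proof.
by case: z => a b /=; rewrite -sqrtr_sqr ler_wsqrtr// lerDr sqr_ge0.
Qed.

Lemma sqr_normcD_le x y :
  normc (x + y) ^+ 2 <= 2 * normc x ^+ 2 + 2 * normc y ^+ 2.
Proof.
have h : normc (x + y) ^+ 2 <= (normc x + normc y) ^+ 2.
  by rewrite ler_sqr ?nnegrE ?addr_ge0 ?normc_ge0// normcD.
have := sqr_ge0 (normc x - normc y); lra.
Qed.

End Modulus.

Arguments ComplexField.Normc.normc : simpl never.

(** * Unconditional summation *)

Section UnconditionalSums.
Context {R : realType}.
Local Open Scope complex_scope.

(** [has_zsum] for an arbitrary index set, since the double series is summed over
    pairs of integers, and with the modulus taken in [R] instead of the complex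
    numbers, which makes the estimates accessible to linear arithmetic. *)
Definition sums (I : choiceType) (u : I -> R[i]) (s : R[i]) :=
  forall eps : R, 0 < eps -> exists A0 : {fset I}, forall A : {fset I},
    (A0 `<=` A)%fset -> normc (\sum_(i <- A) u i - s) < eps.

Definition sum_le (I : choiceType) (f : I -> R) (M : R) :=
  forall A : {fset I}, \sum_(i <- A) f i <= M.

Section OneIndex.
Context {I : choiceType}.
Implicit Types (u v : I -> R[i]) (f g : I -> R).

Lemma sum_le_ge0 f M : sum_le f M -> 0 <= M.
Proof. by move/(_ fset0); rewrite big_seq_fset0. Qed.

Lemma sum_le_mono f g M : (forall i, f i <= g i) -> sum_le g M -> sum_le f M.
Proof. by move=> fg h A; apply: le_trans (h A); apply: ler_sum. Qed.

Lemma sum_leD f g M N :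
  sum_le f M -> sum_le g N -> sum_le (fun i => f i + g i) (M + N).
Proof. by move=> h k A; rewrite big_split/= lerD. Qed.

Lemma sum_leZ c f M : 0 <= c -> sum_le f M -> sum_le (fun i => c * f i) (c * M).
Proof. by move=> c0 h A; rewrite -mulr_sumr ler_wpM2l. Qed.

Lemma big_fset_split (T : nmodType) (w : I -> T) (A B : {fset I}) :
  (A `<=` B)%fset ->
  \sum_(i <- B) w i = \sum_(i <- A) w i + \sum_(i <- (B `\` A)%fset) w i.
Proof.
move=> AB; rewrite (big_fsetID _ (mem A))/=; congr (_ + _); apply: eq_fbigl => i.
  by rewrite !inE/=; apply/andP/idP => [[]//|iA]; rewrite (fsubsetP AB).
by rewrite !inE/= andbC.
Qed.

Lemma ler_sum_fsubset f (A B : {fset I}) : (forall i, 0 <= f i) ->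
  (A `<=` B)%fset -> \sum_(i <- A) f i <= \sum_(i <- B) f i.
Proof. by move=> f0 AB; rewrite (big_fset_split _ AB) lerDl sumr_ge0. Qed.

Lemma sum_le_tail f M eps : (forall i, 0 <= f i) -> sum_le f M -> 0 < eps ->
  exists A0 : {fset I}, forall B : {fset I},
    [disjoint B & A0]%fset -> \sum_(i <- B) f i < eps.
Proof.
move=> f0 fM e0; pose E := [set \sum_(i <- A) f i | A in [set: {fset I}]].
have supE : has_sup E.
  by split; [exists (\sum_(i <- fset0) f i), fset0|exists M => _ [A _ <-]].
have [_ [A0 _ <-] hA0] := sup_adherent e0 supE.
exists A0 => B /fdisjointP BA.
have AB : (A0 `<=` A0 `|` B)%fset by rewrite fsubsetUl.
have : \sum_(i <- (A0 `|` B)%fset) f i <= sup E.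
  by apply: sup_upper_bound => //; exists (A0 `|` B)%fset.
rewrite (big_fset_split _ AB) (_ : \sum_(i <- B) f i =
   \sum_(i <- ((A0 `|` B) `\` A0)%fset) f i); first by move: hA0; lra.
apply: eq_fbigl => i; rewrite !inE.
by case: (boolP (i \in A0)) => //= iA; apply/negP => /BA/negP; rewrite iA.
Qed.

Lemma sums_unique u s t : sums u s -> sums u t -> s = t.
Proof.
move=> us ut; apply/eqP; rewrite -subr_eq0; apply/eqP.
apply: ComplexField.Normc.eq0_normc; apply/eqP; rewrite eq_le normc_ge0 andbT.
apply/ler_addgt0Pl => e e0; rewrite addr0.
have e2 : 0 < e / 2 by rewrite divr_gt0.
have [A hA] := us _ e2; have [B hB] := ut _ e2.
have := hA _ (fsubsetUl A B); have := hB _ (fsubsetUr A B).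
set S := \sum_(_ <- _) _ => h1 h2.
have -> : s - t = (S - t) - (S - s) by ring.
by apply: le_trans (normcB _ _) _; rewrite -/S in h2; lra.
Qed.

Lemma sums_ext u v s : u =1 v -> sums u s -> sums v s.
Proof. by move=> uv us e /us [A hA]; exists A => B /hA; under eq_bigr do rewrite uv. Qed.

Lemma sumsD u v s t : sums u s -> sums v t -> sums (fun i => u i + v i) (s + t).
Proof.
move=> us vt e e0; have e2 : 0 < e / 2 by rewrite divr_gt0.
have [A hA] := us _ e2; have [B hB] := vt _ e2.
exists (A `|` B)%fset => C; rewrite fsubUset => /andP[/hA h1 /hB h2].
rewrite big_split/= opprD addrACA; apply: le_lt_trans (normcD _ _) _; lra.
Qed.

Lemma sumsZ (c : R[i]) u s : sums u s -> sums (fun i => c * u i) (c * s).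
Proof.
move=> us e e0.
have c1 : 0 < normc c + 1 by rewrite ltr_wpDl// normc_ge0.
have [A hA] := us _ (divr_gt0 e0 c1); exists A => B /hA h.
rewrite -mulr_sumr -mulrBr ComplexField.Normc.normcM.
have := normc_ge0 c; move: h; rewrite ltr_pdivlMr// => h c0.
by apply: le_lt_trans h; rewrite mulrC ler_wpM2l ?normc_ge0// lerDl.
Qed.

Lemma sumsN u s : sums u s -> sums (fun i => - u i) (- s).
Proof.
by move=> /(sumsZ (-1)); rewrite mulN1r; apply: sums_ext => i; rewrite mulN1r.
Qed.

Lemma sums0 : sums (fun _ : I => 0) 0.
Proof.
by move=> e e0; exists fset0 => A _; rewrite big1// subrr ComplexField.Normc.normc0.
Qed.

Lemma sums_sum (J : Type) (r : seq J) (u : J -> I -> R[i]) (s : J -> R[i]) :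
  (forall j, sums (u j) (s j)) ->
  sums (fun i => \sum_(j <- r) u j i) (\sum_(j <- r) s j).
Proof.
move=> h; elim: r => [|j r IH].
  by rewrite big_nil; apply: sums_ext sums0 => i; rewrite big_nil.
rewrite big_cons; apply: sums_ext (sumsD (h j) IH) => i.
by rewrite big_cons.
Qed.

Lemma sums_finite u (A : {fset I}) : (forall i, i \notin A -> u i = 0) ->
  sums u (\sum_(i <- A) u i).
Proof.
move=> h e e0; exists A => B AB; rewrite (big_fset_split _ AB) addrC addKr.
rewrite big1_fset ?ComplexField.Normc.normc0// => i; rewrite inE => /andP[iA _] _.
exact: h.
Qed.

(** The sum is the supremum of the finite partial sums. *)
Lemma nonneg_sums f M : (forall i, 0 <= f i) -> sum_le f M ->
  exists s : R, sums (fun i => (f i)%:C) s%:C.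
Proof.
move=> f0 fM; pose E := [set \sum_(i <- A) f i | A in [set: {fset I}]].
have supE : has_sup E.
  by split; [exists (\sum_(i <- fset0) f i), fset0|exists M => _ [A _ <-]].
exists (sup E) => e e0; have [_ [A0 _ <-] hA0] := sup_adherent e0 supE.
exists A0 => A /(ler_sum_fsubset f0) h; rewrite -rmorph_sum -rmorphB normc_real.
have hs : \sum_(i <- A) f i <= sup E by apply: sup_upper_bound => //; exists A.
rewrite ler0_norm; lra.
Qed.

(** [v] is the difference of the nonnegative families [v + f] and [f]. *)
Lemma sums_real_normal (v f : I -> R) M : (forall i, `|v i| <= f i) ->
  sum_le f M -> exists s : R, sums (fun i => (v i)%:C) s%:C.
Proof.
move=> vf fM.
have f0 i : 0 <= f i by apply: le_trans (vf i).
have vM : sum_le v M by apply: sum_le_mono fM => i; exact: le_trans (ler_norm _) (vf i).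
have [|s hs] := nonneg_sums _ (sum_leD vM fM).
  by move=> i; have := vf i; rewrite ler_norml; lra.
have [t ht] := nonneg_sums f0 fM.
exists (s - t); rewrite rmorphB; apply: sums_ext (sumsD hs (sumsN ht)) => i.
by rewrite -rmorphB/= addrK.
Qed.

Lemma sums_normal u f M : (forall i, normc (u i) <= f i) -> sum_le f M ->
  exists s, sums u s.
Proof.
move=> uf fM.
have [i|s hs] := @sums_real_normal (@complex.Re R \o u) f M _ fM.
  exact: le_trans (normr_Re_le _) (uf i).
have [i|t ht] := @sums_real_normal (@complex.Im R \o u) f M _ fM.
  exact: le_trans (normr_Im_le _) (uf i).
exists (s%:C + 'i * t%:C); apply: sums_ext (sumsD hs (sumsZ 'i ht)) => i /=.
by rewrite -complexE.
Qed.

(** The bound depends on [u] only through [f]; for a family of series with the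
    same dominating [f] it is therefore uniform. *)
Lemma sums_dist_le u f s (A0 : {fset I}) (e : R) : sums u s ->
  (forall i, normc (u i) <= f i) ->
  (forall B, [disjoint B & A0]%fset -> \sum_(i <- B) f i <= e) ->
  forall A, (A0 `<=` A)%fset -> normc (\sum_(i <- A) u i - s) <= e.
Proof.
move=> us uf h A A0A; apply/ler_addgt0Pr => d /us[B hB].
have hAB := hB _ (fsubsetUr A B).
set S := \sum_(i <- (A `|` B)%fset) u i in hAB.
have -> : \sum_(i <- A) u i - s = (S - s) - (S - \sum_(i <- A) u i).
  by ring.
apply: le_trans (normcB _ _) _; rewrite addrC lerD// ?(ltW hAB)//.
rewrite /S (big_fset_split _ (fsubsetUl A B)) addrC addKr.
apply: le_trans (normc_sum _ _ _) _; apply: (@le_trans _ _ _ _ _ (ler_sum _ (fun i _ => uf i))).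
apply: h; apply/fdisjointP => i; rewrite !inE => /andP[iA _].
by apply: contra iA; apply: (fsubsetP A0A).
Qed.

Lemma sums_norm_le u f s M : sums u s -> (forall i, normc (u i) <= f i) ->
  sum_le f M -> normc s <= M.
Proof.
move=> us uf fM; have := @sums_dist_le u f s fset0 M us uf (fun B _ => fM B) fset0.
rewrite big_seq_fset0 sub0r => /(_ (fsubset_refl _)).
by rewrite (@normcN R s).
Qed.

Lemma nonneg_sum_le f (s : R) : (forall i, 0 <= f i) ->
  sums (fun i => (f i)%:C) s%:C -> sum_le f s.
Proof.
move=> f0 fs A; apply/ler_addgt0Pr => e /fs[B /(_ _ (fsubsetUr A B))].
rewrite -rmorph_sum -rmorphB normc_real => h.
apply: le_trans (ler_sum_fsubset f0 (fsubsetUl A B)) _.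
by move: h; rewrite ltr_norml; lra.
Qed.

Lemma sums_le_of_partial f (s M : R) :
  sums (fun i => (f i)%:C) s%:C -> sum_le f M -> s <= M.
Proof.
move=> fs fM; apply/ler_addgt0Pr => e /fs[B /(_ _ (fsubset_refl B))].
rewrite -rmorph_sum -rmorphB normc_real => h.
by have := fM B; move: h; rewrite ltr_norml; lra.
Qed.

End OneIndex.

Section TwoIndices.
Context {I J : choiceType}.

Lemma sum_le_inj (phi : I -> J) (f : J -> R) M : injective phi ->
  sum_le f M -> sum_le (fun i => f (phi i)) M.
Proof.
move=> inj h A; have := h [fset phi i | i in A]%fset.
by rewrite big_imfset//= => x y _ _ /inj.
Qed.

Lemma sums_reindex (phi : I -> J) (psi : J -> I) (u : J -> R[i]) s :
  cancel phi psi -> cancel psi phi -> sums u s -> sums (fun i => u (phi i)) s.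
Proof.
move=> phiK psiK us e /us[A hA]; exists [fset psi j | j in A]%fset => B AB.
have inj : {in B &, injective phi} by move=> x y _ _ /(can_inj phiK).
have := hA [fset phi i | i in B]%fset; rewrite big_imfset//=; apply.
apply/fsubsetP => j jA; rewrite -(psiK j); apply: in_imfset => /=.
by apply: (fsubsetP AB); exact: in_imfset.
Qed.

Lemma sum_le_pair (f : I -> J -> R) (r : I -> R) M :
  (forall i j, 0 <= f i j) -> (forall i, sum_le (f i) (r i)) -> sum_le r M ->
  sum_le (fun p : I * J => f p.1 p.2) M.
Proof.
move=> f0 fr rM A; pose A1 := [fset p.1 | p in A]%fset.
pose A2 := [fset p.2 | p in A]%fset.
have sub : (A `<=` A1 `*` A2)%fset.
  by apply/fsubsetP => -[i j] ijA; rewrite in_fsetM !in_imfset.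
apply: le_trans (ler_sum_fsubset (fun p => f0 p.1 p.2) sub) _.
apply: le_trans (rM A1); rewrite big_imfset2/=; last by move=> [? ?] [? ?] _ _ /= [-> ->].
by apply: ler_sum => i _; exact: fr.
Qed.

(** For finitely many rows, the inner sums are approximated simultaneously by a
    finite rectangle, and a sum over a large rectangle is close to [S]. *)
Lemma sums_fubini (u : I -> J -> R[i]) (s : I -> R[i]) S :
  sums (fun p : I * J => u p.1 p.2) S -> (forall i, sums (u i) (s i)) ->
  sums s S.
Proof.
move=> uS us e e0; have e2 : 0 < e / 2 by rewrite divr_gt0.
have [A hA] := uS _ e2; exists [fset p.1 | p in A]%fset => B AB.
have [G hG] := sums_sum (enum_fset B) us e2.
pose G' := (G `|` [fset p.2 | p in A])%fset.
have h1 := hG _ (fsubsetUl G [fset p.2 | p in A]%fset).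
have sub : (A `<=` B `*` G')%fset.
  apply/fsubsetP => -[i j] ijA; rewrite in_fsetM/=; apply/andP; split.
    by apply: (fsubsetP AB); apply/imfsetP; exists (i, j).
  by rewrite inE; apply/orP; right; apply/imfsetP; exists (i, j).
have := hA _ sub; rewrite big_imfset2/=; last by move=> [? ?] [? ?] _ _ /= [-> ->].
rewrite exchange_big/= => h2.
set X := \sum_(i <- B) _ in h1 *; set Y := \sum_(i <- _) _ in h1 h2.
have -> : X - S = (Y - S) - (Y - X) by ring.
by apply: le_lt_trans (normcB _ _) _; rewrite -/Y in h2; lra.
Qed.

End TwoIndices.

Lemma has_zsumP (u : int -> R[i]) s : has_zsum u s <-> sums u s.
Proof.
have pE (A : {fset int}) :
    summability.partial_sum (u : int -> R[i]^o) A = \sum_(i <- A) u i.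
  by rewrite big_seq_fsetE.
pose F := @summability.totally_filter int; split => [/cvgrPdist_lt h e e0|h].
  have e0C : 0 < e%:C :> R[i] by rewrite ltcR.
  have [A0 _ hA0] := h _ e0C; exists A0 => A /hA0 /=.
  by rewrite pE normc_def ltcR normc_distC; case: (_ - _).
apply/cvgrPdist_lt => e e0.
have eE : e = (complex.Re e)%:C.
  by move: e0; rewrite ltcE/= => /andP[/eqP]; case: e => a b /= ->.
have e0R : 0 < complex.Re e by rewrite -ltcR -eE.
have [A0 hA0] := h _ e0R; exists A0 => // A /hA0 /=.
by rewrite pE eE normc_def ltcR normc_distC; case: (_ - _).
Qed.

Lemma sums_zsum (u : int -> R[i]) s : sums u s -> zsum u = s.
Proof.
move/has_zsumP => h; pose F := @summability.totally_filter int.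
apply: (@cvg_lim R[i]^o) h; exact: norm_hausdorff.
Qed.

Lemma sums_zsumP (u : int -> R[i]) s : sums u s -> sums u (zsum u).
Proof. by move=> h; rewrite (sums_zsum h). Qed.

End UnconditionalSums.

(** * The sinc function *)

Section Sinc.
Context {R : realType}.
Implicit Types (x y t u : R) (k m n : int).

Lemma FTC_derive (F f : R -> R) (a b : R) : a < b -> continuous f ->
  (forall x, is_derive x 1 F (f x)) ->
  \int[lebesgue_measure]_(x in `[a, b]) f x = F b - F a.
Proof.
move=> ab cf dF; rewrite /Rintegral (@continuous_FTC2 _ f F)//.
- exact: continuous_subspaceT.
- have cF x : {for x, continuous F}.
    by apply: differentiable_continuous; apply/derivable1_diffP; case: (dF x).
  split => [x _||].
  + by case: (dF x).
  + by apply: cvg_at_right_filter; exact: cF.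
  + by apply: cvg_at_left_filter; exact: cF.
- by move=> x _; rewrite derive1E; apply: derive_val.
Qed.

Lemma integrable_continuous_itv (f : R -> R) (a b : R) : continuous f ->
  (@lebesgue_measure R).-integrable `[a, b] (EFin \o f).
Proof.
move=> cf; apply: continuous_compact_integrable; first exact: segment_compact.
exact: continuous_subspaceT.
Qed.

Lemma continuous_sum (I : Type) (s : seq I) (F : I -> R -> R) :
  (forall i, continuous (F i)) -> continuous (fun x => \sum_(i <- s) F i x).
Proof.
move=> cF; elim: s => [|i s IH] x.
  by under eq_fun do rewrite big_nil; exact: cvg_cst.
by under eq_fun do rewrite big_cons; apply: continuousD; [exact: cF|exact: IH].
Qed.

Lemma Rintegral_itv_sum (I : Type) (s : seq I) (F : I -> R -> R) (a b : R) :
  (forall i, continuous (F i)) ->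
  \int[lebesgue_measure]_(x in `[a, b]) (\sum_(i <- s) F i x) =
  \sum_(i <- s) \int[lebesgue_measure]_(x in `[a, b]) F i x.
Proof.
move=> cF; elim: s => [|i s IH].
  rewrite big_nil; under eq_Rintegral do rewrite big_nil.
  by rewrite Rintegral_cst//= mul0r.
rewrite big_cons -IH; under eq_Rintegral do rewrite big_cons.
apply: RintegralD => //; first exact: integrable_continuous_itv.
by apply: integrable_continuous_itv; exact: continuous_sum.
Qed.

Lemma sinc0 : sinc (0 : R) = 1. Proof. by rewrite /sinc eqxx. Qed.

Lemma sincN x : sinc (- x) = sinc x.
Proof.
by rewrite /sinc oppr_eq0; case: eqP => // _; rewrite mulrN sinN invrN mulrNN.
Qed.

Lemma mul_sinc x : pi * x * sinc x = sin (pi * x).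
Proof.
rewrite /sinc; case: eqP => [->|/eqP x0]; first by rewrite !mulr0 mul0r sin0.
by rewrite mulrC divfK// mulf_neq0// gt_eqF// pi_gt0.
Qed.

Lemma sinc_double x : sinc (2 * x) = sinc x * cos (pi * x).
Proof.
have [->|x0] := eqVneq x 0; first by rewrite !mulr0 sinc0 cos0 mulr1.
have px : pi * x != 0 by rewrite mulf_neq0// gt_eqF// pi_gt0.
apply: (mulfI px); rewrite [RHS]mulrA mul_sinc.
have := mul_sinc (2 * x); rewrite (_ : pi * (2 * x) = (pi * x) *+ 2); last by ring.
rewrite sin_mulr2n => e; apply: (@mulfI _ 2) => //.
by transitivity ((pi * x) *+ 2 * sinc (2 * x)); [ring|rewrite e; ring].
Qed.

Lemma sin_cos_shift x n :
  sin (pi * (x - n%:~R)) = (-1) ^ n * sin (pi * x) /\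
  cos (pi * (x - n%:~R)) = (-1) ^ n * cos (pi * x).
Proof.
have sg (k : int) : (-1 : R) ^ (k + 1) = - (-1) ^ k.
  by rewrite exprzDr ?unitrN1// expr1z mulrN1.
have step (y : R) : sin (pi * (y - 1)) = - sin (pi * y) /\
                    cos (pi * (y - 1)) = - cos (pi * y).
  have e : pi * y = pi * (y - 1) + pi by ring.
  by rewrite [in RHS]e [X in _ /\ _ = - cos X]e sinDpi cosDpi !opprK.
elim/int_rec: n => [|n [IHs IHc]|n [IHs IHc]].
- by rewrite subr0 expr0z !mul1r.
- have -> : x - n.+1%:~R = (x - n%:~R) - 1 by rewrite -addn1 PoszD intrD; ring.
  have [-> ->] := step (x - n%:~R).
  by rewrite IHs IHc -addn1 PoszD sg !mulNr.
- have [] := step (x - (- n.+1%:Z)%:~R).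
  have -> : x - (- n.+1%:Z)%:~R - 1 = x - (- n%:Z)%:~R :> R.
    by rewrite -addn1 PoszD opprD intrD; ring.
  have := sg (- n.+1%:Z); rewrite (_ : - n.+1%:Z + 1 = - n%:Z); last by lia.
  by rewrite IHs IHc => -> /eqP; rewrite mulNr eqr_opp => /eqP -> /eqP; rewrite mulNr eqr_opp => /eqP ->.
Qed.

Lemma sqr_signz n : ((-1) ^ n) * ((-1) ^ n) = 1 :> R.
Proof. by rewrite -expfzMl mulrNN mulr1 exp1rz. Qed.

Lemma norm_signz n : `|(-1 : R) ^ n| = 1.
Proof.
have /eqP := sqr_signz n; rewrite -expr2 sqrf_eq1 => /orP[] /eqP ->.
  exact: normr1.
by rewrite normrN1.
Qed.

Lemma sin_pi_int n : sin (pi * n%:~R : R) = 0.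
Proof.
have [] := sin_cos_shift 0 (- n).
by rewrite mulrNz opprK add0r mulr0 sin0 mulr0.
Qed.

Lemma sinc_int n : sinc (n%:~R : R) = (n == 0)%:R.
Proof.
rewrite /sinc intr_eq0; case: eqP => // _.
by rewrite sin_pi_int mul0r.
Qed.

(** The mean value theorem for [sin] exhibits [sinc x] as a cosine, which gives
    both [`|sinc x| <= 1] and, for [`|x| <= 1/2], the comparison of the defect
    [1 - sinc x ^+ 2] with [sin (pi * x) ^+ 2]. *)
Lemma sinc_eq_cos x : 0 < x ->
  exists2 c, 0 < c < pi * x & sinc x = cos c.
Proof.
move=> x0; have px : 0 < pi * x by rewrite mulr_gt0// pi_gt0.
have [|c cx] := @MVT R sin cos 0 (pi * x) px (fun y _ => is_derive_sin y).
  by apply: continuous_subspaceT; exact: continuous_sin.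
rewrite sin0 !subr0 => e; exists c; first by move: cx; rewrite in_itv.
by rewrite /sinc gt_eqF// e mulfK// gt_eqF.
Qed.

Lemma sinc_le1 x : `|sinc x| <= 1.
Proof.
wlog x0 : x / 0 <= x.
  by move=> h; have [/h//|/ltW] := lerP 0 x; rewrite -oppr_ge0 => /h; rewrite sincN.
move: x0; rewrite le_eqVlt => /predU1P[<-|/sinc_eq_cos[c _ ->]].
  by rewrite sinc0 normr1.
exact: cos_max.
Qed.

Lemma sinc_defect x : `|x| <= 2^-1 -> 1 - sinc x ^+ 2 <= sin (pi * x) ^+ 2.
Proof.
wlog x0 : x / 0 <= x.
  move=> h; have [/h//|/ltW] := lerP 0 x; rewrite -oppr_ge0 => /h.
  by rewrite sincN normrN mulrN sinN sqrrN.
rewrite ger0_norm// => x2.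
move: x0; rewrite le_eqVlt => /predU1P[<-|x0].
  by rewrite sinc0 expr1n subrr sqr_ge0.
have [c /andP[c0 cx] ->] := sinc_eq_cos x0.
have xpi : pi * x <= pi / 2 by rewrite ler_wpM2l// pi_ge0.
have p0 := @pi_gt0 R.
rewrite -sin2cos2 ler_sqr ?nnegrE ?sin_ge0_pi//.
- rewrite ltW// ltr_sin// in_itv/=; apply/andP; split; nra.
- apply/andP; split; nra.
- apply/andP; split; nra.
Qed.

Lemma sinc_decay x : (1 + `|x|) * `|sinc x| <= 2.
Proof.
rewrite mulrDl mul1r (_ : 2 = 1 + 1 :> R)// lerD ?sinc_le1//.
have := sin_max (pi * x); rewrite -mul_sinc !normrM => h.
have p2 := @pi_ge2 R; apply: le_trans h; rewrite ger0_norm ?pi_ge0//.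
by rewrite -mulrA ler_peMl ?mulr_ge0//; lra.
Qed.

Lemma mul_sinc_le1 x : `|x * sinc x| <= 1.
Proof.
have := sin_max (pi * x); rewrite -mul_sinc -mulrA normrM => h.
have p2 := @pi_ge2 R; apply: le_trans h; rewrite ger0_norm ?pi_ge0//.
by rewrite ler_peMl//; lra.
Qed.

Lemma continuous_cos_affine (al be : R) : continuous (fun t => cos (al + be * t)).
Proof.
move=> t; apply: (@continuous_comp _ _ _ (fun t => al + be * t) cos).
  by apply: continuousD; [exact: cvg_cst|apply: continuousM; [exact: cvg_cst|]].
exact: continuous_cos.
Qed.

Lemma continuous_sin_affine (al be : R) : continuous (fun t => sin (al + be * t)).
Proof.
move=> t; apply: (@continuous_comp _ _ _ (fun t => al + be * t) sin).
  by apply: continuousD; [exact: cvg_cst|apply: continuousM; [exact: cvg_cst|]].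
exact: continuous_sin.
Qed.

Lemma integral_cos_sinc (al u : R) :
  \int[lebesgue_measure]_(t in `[- 2^-1, 2^-1]) cos (al + 2 * pi * u * t) =
  cos al * sinc u.
Proof.
have ab : - 2^-1 < 2^-1 :> R by lra.
have [->|u0] := eqVneq u 0.
  under eq_Rintegral do rewrite mulr0 mul0r addr0.
  have dF (x : R) : is_derive x 1 (fun t => cos al * t) (cos al).
    by apply: is_derive_eq; rewrite /GRing.scale/= mulr1 ?mulr0 ?add0r ?addr0.
  rewrite (@FTC_derive _ (fun=> cos al) _ _ ab _ dF); first by rewrite sinc0; field.
  by move=> x; exact: cvg_cst.
have p0 : pi != 0 :> R by rewrite gt_eqF// pi_gt0.
pose F t := (2 * pi * u)^-1 * sin (al + 2 * pi * u * t).
have dF (x : R) : is_derive x 1 F (cos (al + 2 * pi * u * x)).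
  apply: is_derive_eq.
  rewrite /GRing.scale/= !mulr1 ?mulr0 ?addr0 ?add0r.
  by move: (@pi R) p0 => q q0; field; rewrite u0.
rewrite (FTC_derive ab (@continuous_cos_affine al (2 * pi * u)) dF) /F.
have -> : al + 2 * pi * u * 2^-1 = al + pi * u by field.
have -> : al + 2 * pi * u * - 2^-1 = al - pi * u by field.
rewrite sinD sinB /sinc (negbTE u0).
by move: (@pi R) p0 => q q0; field; rewrite u0.
Qed.

End Sinc.

(** * Bessel's inequality and the reproducing formula *)

Section Gram.
Context {R : realType}.
Local Open Scope complex_scope.
Implicit Types (v w : seq (R[i] * R)) (x y : R).
Local Notation mu := (@lebesgue_measure R).

Definition trig_poly v (t : R) : R[i] :=
  \sum_(p <- v) p.1 * cis (2 * pi * p.2 * t).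

(** The real part of the inner product of two trigonometric polynomials in
    L^2 of [[-1/2, 1/2]]. *)
Definition gram v w : R :=
  \sum_(p <- v) \sum_(q <- w) complex.Re (p.1 * q.1^*) * sinc (p.2 - q.2).

Lemma Re_sum (I : Type) (s : seq I) (u : I -> R[i]) :
  complex.Re (\sum_(i <- s) u i) = \sum_(i <- s) complex.Re (u i).
Proof. by apply: (big_morph (@complex.Re R)) => // -[a b] [c d]. Qed.

Lemma Im_sum (I : Type) (s : seq I) (u : I -> R[i]) :
  complex.Im (\sum_(i <- s) u i) = \sum_(i <- s) complex.Im (u i).
Proof. by apply: (big_morph (@complex.Im R)) => // -[a b] [c d]. Qed.

Lemma sqr_normc_conj (z : R[i]) : normc z ^+ 2 = complex.Re (z * z^*).
Proof. by case: z => a b; rewrite sqr_normc_Re_Im /=; ring. Qed.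

(** The sine of the angle is written as a shifted cosine, so that a single integral,
    [integral_cos_sinc], serves for all the terms. *)
Lemma sqr_normc_trig_poly v t : normc (trig_poly v t) ^+ 2 =
  \sum_(p <- v) \sum_(q <- v)
   (complex.Re (p.1 * q.1^*) * cos (0 + 2 * pi * (p.2 - q.2) * t) -
    complex.Im (p.1 * q.1^*) * cos (- (pi / 2) + 2 * pi * (p.2 - q.2) * t)).
Proof.
rewrite sqr_normc_conj /trig_poly rmorph_sum/= mulr_suml Re_sum.
apply: eq_bigr => -[[a b] x] _; rewrite mulr_sumr Re_sum.
apply: eq_bigr => -[[c d] y] _ /=.
rewrite add0r [- (pi / 2) + _]addrC cosBpihalf.
rewrite (_ : 2 * pi * (x - y) * t = 2 * pi * x * t - 2 * pi * y * t); last by ring.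
by rewrite cosB sinB; ring.
Qed.

Lemma integral_sqr_trig_poly v :
  \int[mu]_(t in `[- 2^-1, 2^-1]) (normc (trig_poly v t) ^+ 2) = gram v v.
Proof.
under eq_Rintegral do rewrite sqr_normc_trig_poly.
have cF (p q : R[i] * R) : continuous (fun t =>
    complex.Re (p.1 * q.1^*) * cos (0 + 2 * pi * (p.2 - q.2) * t) -
    complex.Im (p.1 * q.1^*) * cos (- (pi / 2) + 2 * pi * (p.2 - q.2) * t)).
  move=> t; apply: cvgB; apply: cvgM; try exact: cvg_cst;
    exact: continuous_cos_affine.
rewrite Rintegral_itv_sum => [|p]; last exact: continuous_sum.
apply: eq_bigr => p _; rewrite Rintegral_itv_sum//; apply: eq_bigr => q _.
have ic (a b c : R) : mu.-integrable `[- 2^-1, 2^-1]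
    (EFin \o (fun t => c * cos (a + b * t))).
  apply: integrable_continuous_itv => t; apply: continuousM; first exact: cvg_cst.
  exact: continuous_cos_affine.
have ic1 (a b : R) : mu.-integrable `[- 2^-1, 2^-1]
    (EFin \o (fun t => cos (a + b * t))).
  by apply: integrable_continuous_itv; exact: continuous_cos_affine.
rewrite RintegralB// !RintegralZl// !integral_cos_sinc cosN cos_pihalf cos0.
by rewrite mul1r mul0r mulr0 subr0.
Qed.

Lemma gram_ge0 v : 0 <= gram v v.
Proof. by rewrite -integral_sqr_trig_poly Rintegral_ge0// => x _; rewrite sqr_ge0. Qed.

Lemma gram_catl v v' w : gram (v ++ v') w = gram v w + gram v' w.
Proof. by rewrite /gram big_cat. Qed.

Lemma gram_sym v w : gram v w = gram w v.
Proof.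
rewrite /gram exchange_big/=; apply: eq_bigr => p _; apply: eq_bigr => q _.
rewrite -opprB sincN; congr (_ * _); case: p q => [[a b] x] [[c d] y] /=; ring.
Qed.

Lemma gram_catr v w w' : gram v (w ++ w') = gram v w + gram v w'.
Proof. by rewrite gram_sym gram_catl !(gram_sym v). Qed.

Lemma gram_integers (A : {fset int}) (c : int -> R[i]) (phi : int -> int) (s : R) :
  injective phi ->
  let e := [seq (c n, (phi n)%:~R + s) | n <- A] in
  gram e e = \sum_(n <- A) normc (c n) ^+ 2.
Proof.
move=> inj; rewrite /gram big_map; apply: eq_big_seq => n nA; rewrite big_map/=.
rewrite (big_fsetD1 n)//= big1_fset => [|m]; last first.
  rewrite !inE => /andP[mn _] _; rewrite (_ : _ - _ = (phi n - phi m)%:~R); last first.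
    by rewrite intrD mulrNz; ring.
  by rewrite sinc_int subr_eq0 (inj_eq inj) eq_sym (negbTE mn) mulr0.
by rewrite subrr sinc0 mulr1 addr0 sqr_normc_conj.
Qed.

(** Bessel's inequality for the exponentials with frequencies [m + s], which are
    orthonormal because [sinc] vanishes at the nonzero integers: the Gram form is
    nonnegative on the difference of [v] and its orthogonal projection. *)
Lemma bessel v (s : R) : sum_le
  (fun m : int => normc (\sum_(p <- v) p.1 * (sinc (p.2 - (m%:~R + s)))%:C) ^+ 2)
  (gram v v).
Proof.
move=> A; pose be m := \sum_(p <- v) p.1 * (sinc (p.2 - (m%:~R + s)))%:C.
pose w := [seq (- be m, m%:~R + s) | m <- A].
have gvw : gram v w = - \sum_(m <- A) normc (be m) ^+ 2.
  rewrite /gram exchange_big big_map -sumrN; apply: eq_bigr => m _ /=.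
  rewrite sqr_normc_conj {2}/be mulr_suml Re_sum -[RHS]sumrN.
  apply: eq_bigr => -[[a b] x] _ /=; case: (be m) => c d /=; ring.
have := gram_ge0 (v ++ w).
rewrite gram_catl !gram_catr (gram_sym w) gvw (gram_integers _ _ _ (@inj_id int)).
by under [\sum_(n <- A) normc (- _) ^+ 2]eq_bigr do rewrite normcN; lra.
Qed.

Lemma normc_real_sqr x : normc x%:C ^+ 2 = x ^+ 2.
Proof. by rewrite normc_real real_normK ?num_real. Qed.

Lemma sinc_sqr_sum_le1 x : sum_le (fun k : int => sinc (x - k%:~R) ^+ 2) 1.
Proof.
have := bessel [:: (1, x)] 0; rewrite /gram !big_cons !big_nil/=.
rewrite !addr0 subrr sinc0 oppr0 !mulr0 subr0 !mulr1; apply: sum_le_mono => k.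
by rewrite big_cons big_nil /= ?addr0 ?mul1r normc_real_sqr.
Qed.

Lemma sinc_sqr_sums x :
  exists s : R, sums (fun k : int => (sinc (x - k%:~R) ^+ 2)%:C) s%:C.
Proof. by apply: nonneg_sums (sinc_sqr_sum_le1 x) => k; rewrite sqr_ge0. Qed.

(** Splitting into even and odd translates, with the duplication formula for
    [sinc]. *)
Lemma sinc_sqr_sum_double x s s1 s2 :
  sums (fun k : int => (sinc (x - k%:~R) ^+ 2)%:C) s%:C ->
  sums (fun k : int => (sinc (x / 2 - k%:~R) ^+ 2)%:C) s1%:C ->
  sums (fun k : int => (sinc ((x - 1) / 2 - k%:~R) ^+ 2)%:C) s2%:C ->
  cos (pi * (x / 2)) ^+ 2 * s1 + sin (pi * (x / 2)) ^+ 2 * s2 <= s.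
Proof.
move=> hs h1 h2.
have le_s := nonneg_sum_le (fun k => sqr_ge0 _) hs.
have ev (y : R) (k : int) : sinc (2 * (y - k%:~R)) ^+ 2 =
    cos (pi * y) ^+ 2 * sinc (y - k%:~R) ^+ 2.
  rewrite sinc_double (sin_cos_shift y k).2 !exprMn [((-1) ^ k) ^+ 2]expr2.
  by rewrite sqr_signz mul1r mulrC.
have odd_cos : cos (pi * ((x - 1) / 2)) = sin (pi * (x / 2)).
  by rewrite -cosBpihalf; congr cos; field.
have fin (A B : {fset int}) :
    cos (pi * (x / 2)) ^+ 2 * (\sum_(k <- A) sinc (x / 2 - k%:~R) ^+ 2) +
    sin (pi * (x / 2)) ^+ 2 * (\sum_(k <- B) sinc ((x - 1) / 2 - k%:~R) ^+ 2) <= s.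
  pose A' := [fset (2 * k)%R | k in A]%fset; pose B' := [fset (2 * k + 1)%R | k in B]%fset.
  have -> : cos (pi * (x / 2)) ^+ 2 * (\sum_(k <- A) sinc (x / 2 - k%:~R) ^+ 2) =
      \sum_(k <- A') sinc (x - k%:~R) ^+ 2.
    rewrite big_imfset/=; last by move=> i j _ _; lia.
    rewrite mulr_sumr; apply: eq_bigr => k _; rewrite -ev; congr (sinc _ ^+ 2).
    by rewrite intrM; field.
  have -> : sin (pi * (x / 2)) ^+ 2 * (\sum_(k <- B) sinc ((x - 1) / 2 - k%:~R) ^+ 2)
      = \sum_(k <- B') sinc (x - k%:~R) ^+ 2.
    rewrite big_imfset/=; last by move=> i j _ _; lia.
    rewrite mulr_sumr; apply: eq_bigr => k _; rewrite -odd_cos -ev.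
    by congr (sinc _ ^+ 2); rewrite intrD intrM; field.
  apply: le_trans (le_s (A' `|` B')%fset).
  rewrite (big_fset_split _ (fsubsetUl A' B')) lerD2l.
  rewrite le_eqVlt; apply/orP; left; apply/eqP; apply: eq_fbigl => k.
  rewrite !inE; case: (boolP (k \in B')) => kB'; last first.
    by case: (k \in A').
  rewrite orbT andbT; apply/esym/negP => /imfsetP[i /= _ ki].
  by move: kB' => /imfsetP[j /= _]; lia.
have {}h1 : sums (fun k : int => (cos (pi * (x / 2)) ^+ 2 *
    sinc (x / 2 - k%:~R) ^+ 2)%:C) (cos (pi * (x / 2)) ^+ 2 * s1)%:C.
  by rewrite rmorphM; apply: sums_ext (sumsZ _ h1) => k; rewrite -rmorphM.
have {}h2 : sums (fun k : int => (sin (pi * (x / 2)) ^+ 2 *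
    sinc ((x - 1) / 2 - k%:~R) ^+ 2)%:C) (sin (pi * (x / 2)) ^+ 2 * s2)%:C.
  by rewrite rmorphM; apply: sums_ext (sumsZ _ h2) => k; rewrite -rmorphM.
rewrite -lerBrDr; apply: (sums_le_of_partial h1) => A.
rewrite lerBrDr addrC -lerBrDr; apply: (sums_le_of_partial h2) => B.
by rewrite lerBrDr addrC -!mulr_sumr.
Qed.

(** The Herglotz trick. By Bessel the defect [d x] of the sum is nonnegative;
    the term of the nearest integer shows [d x <= sin (pi * x) ^+ 2], and the
    duplication formula halves the constant in such an inequality, because
    [sin (pi * x) ^+ 2 = 4 * sin (pi * x / 2) ^+ 2 * cos (pi * x / 2) ^+ 2]. *)
Lemma sinc_sqr_sumsE x :
  sums (fun k : int => (sinc (x - k%:~R) ^+ 2)%:C) (1 : R[i]).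
Proof.
have [S hS] := choice (@sinc_sqr_sums).
have S1 y : S y <= 1 by apply: sums_le_of_partial (hS y) (sinc_sqr_sum_le1 y).
have bound n y : 1 - S y <= sin (pi * y) ^+ 2 / 2 ^+ n.
  elim: n y => [|n IH] y.
    rewrite expr0 divr1; pose m := Num.floor (y + 2^-1).
    have /andP[m1 m2] := Num.Theory.floor_itv (y + 2^-1).
    rewrite -/m intrD in m1 m2.
    have ym : `|y - m%:~R| <= 2^-1 by rewrite ler_norml; apply/andP; split; lra.
    have := sinc_defect ym; rewrite (sin_cos_shift y m).1 exprMn.
    rewrite [((-1) ^ m) ^+ 2]expr2 sqr_signz mul1r; apply: le_trans.
    rewrite lerB//; have := nonneg_sum_le (fun k => sqr_ge0 _) (hS y) [fset m]%fset.
    by rewrite big_seq_fset1.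
  have h := sinc_sqr_sum_double (hS y) (hS (y / 2)) (hS ((y - 1) / 2)).
  have i1 := IH (y / 2); have i2 := IH ((y - 1) / 2).
  have es : sin (pi * ((y - 1) / 2)) = - cos (pi * (y / 2)).
    by rewrite -sinBpihalf; congr sin; field.
  have ed : sin (pi * y) = 2 * sin (pi * (y / 2)) * cos (pi * (y / 2)).
    rewrite (_ : pi * y = (pi * (y / 2)) *+ 2); last by field.
    by rewrite sin_mulr2n; ring.
  rewrite es sqrrN in i2; rewrite ed.
  set c := cos _ in h i1 i2 *; set t := sin _ in h i1 i2 *.
  have ct : c ^+ 2 + t ^+ 2 = 1 by rewrite cos2Dsin2.
  set q := 2 ^+ n in i1 i2.
  have -> : (2 * t * c) ^+ 2 / 2 ^+ n.+1 = 2 * (t ^+ 2 * c ^+ 2 / q) :> R.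
    have q0 : q != 0 by rewrite expf_neq0.
    by rewrite [2 ^+ n.+1]exprS -/q; move: (q) q0 (t) (c) => r r0 a b; field.
  have j1 : c ^+ 2 * (1 - S (y / 2)) <= c ^+ 2 * (t ^+ 2 / q) by rewrite ler_wpM2l ?sqr_ge0.
  have j2 : t ^+ 2 * (1 - S ((y - 1) / 2)) <= t ^+ 2 * (c ^+ 2 / q) by rewrite ler_wpM2l ?sqr_ge0.
  have -> : 2 * (t ^+ 2 * c ^+ 2 / q) = c ^+ 2 * (t ^+ 2 / q) + t ^+ 2 * (c ^+ 2 / q) by ring.
  apply: le_trans (lerD j1 j2); rewrite -[in X in X <= _]ct; lra.
suff -> : 1 = (S x)%:C :> R[i] by exact: hS.
congr (_ %:C); apply/eqP; rewrite eq_le S1 andbT -subr_le0.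
apply/ler_addgt0Pl => e e0; rewrite addr0.
have [n hn] : exists n : nat, e^-1 < n%:R :> R.
  by exists (Num.bound e^-1); by apply: archi_boundP; rewrite invr_ge0 ltW.
apply: le_trans (bound n x) _.
have hq : n%:R <= 2 ^+ n :> R by rewrite -natrX ler_nat ltnW// ltn_expl.
have q0 : 0 < 2 ^+ n :> R by rewrite exprn_gt0.
rewrite ler_pdivrMr//; apply: le_trans (_ : 1 <= _).
  by rewrite sin2cos2 gerBl sqr_ge0.
by rewrite -ler_pdivrMl// mulr1; apply: le_trans hq; exact: ltW.
Qed.

(** The reproducing formula of the Paley-Wiener space. Applied to
    [e_x + eps * e_y] with [eps = 1] and [eps = -1], Bessel's inequality bounds
    the left-hand side from both sides once the sums of squares are known to
    be [1]. *)
Lemma sinc_reproducing x y :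
  sums (fun k : int => (sinc (x - k%:~R) * sinc (y - k%:~R))%:C)
       (sinc (x - y))%:C.
Proof.
have [k|P hP] := @sums_real_normal R int
    (fun k => sinc (x - k%:~R) * sinc (y - k%:~R))
    (fun k => sinc (x - k%:~R) ^+ 2 + sinc (y - k%:~R) ^+ 2) (1 + 1) _
    (sum_leD (sinc_sqr_sum_le1 x) (sinc_sqr_sum_le1 y)).
  have := sqr_ge0 (sinc (x - k%:~R) + sinc (y - k%:~R)).
  have := sqr_ge0 (sinc (x - k%:~R) - sinc (y - k%:~R)).
  have := sqr_ge0 (sinc (x - k%:~R)); have := sqr_ge0 (sinc (y - k%:~R)).
  by rewrite ler_norml; nra.
have half (eps : R) : eps ^+ 2 = 1 -> eps * P <= eps * sinc (x - y).
  move=> e2; have h := bessel [:: (1, x); (eps%:C, y)] 0.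
  have hs : sums (fun k : int => ((sinc (x - k%:~R) + eps * sinc (y - k%:~R)) ^+ 2)%:C)
      (1 + 1 + 2 * eps * P)%:C.
    rewrite !rmorphD rmorph1 rmorphM.
    apply: sums_ext (sumsD (sumsD (sinc_sqr_sumsE x) (sinc_sqr_sumsE y)) (sumsZ _ hP)) => k.
    rewrite -rmorphM -!rmorphD; congr (_ %:C).
    by rewrite sqrrD exprMn e2; ring.
  have pw (k : int) : (sinc (x - k%:~R) + eps * sinc (y - k%:~R)) ^+ 2 <=
      normc (\sum_(p <- [:: (1, x); (eps%:C, y)])
              p.1 * (sinc (p.2 - (k%:~R + 0)))%:C) ^+ 2.
    rewrite !big_cons big_nil/= !addr0 mul1r -rmorphM -rmorphD.
    by rewrite normc_real_sqr.
  have := sums_le_of_partial hs (sum_le_mono pw h).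
  rewrite /gram !big_cons !big_nil/= !subrr sinc0 -[y - x]opprB sincN.
  rewrite !oppr0 !mulr0 !subr0 !addr0 !mulr1 !mul1r -expr2 e2; lra.
have hp := half 1 (expr1n _ _); have hm := half (-1) (etrans (sqrrN 1) (expr1n _ _)).
by suff -> : sinc (x - y) = P by []; lra.
Qed.

End Gram.

(** * Summability of the double series *)

Section Weights.
Context {R : realType}.
Implicit Types (n k j : int).

Definition wt n : R := 1 + `|n%:~R|.
(** The fourth root turns the weights [|n| ^ (5/4)] into polynomials. *)
Definition rt n : R := Num.sqrt (Num.sqrt (wt n)).

Lemma wt_ge1 n : 1 <= wt n. Proof. by rewrite lerDl. Qed.

Lemma wt_gt0 n : 0 < wt n. Proof. exact: lt_le_trans ltr01 (wt_ge1 n). Qed.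

Lemma rt_pow4 n : rt n ^+ 4 = wt n.
Proof. by rewrite (exprM _ 2 2) !sqr_sqrtr ?sqrtr_ge0// ltW// wt_gt0. Qed.

Lemma rt_ge1 n : 1 <= rt n.
Proof.
rewrite -(@ler_pXn2r _ 4) ?nnegrE ?sqrtr_ge0// expr1n rt_pow4; exact: wt_ge1.
Qed.

Lemma rt_gt0 n : 0 < rt n. Proof. exact: lt_le_trans ltr01 (rt_ge1 n). Qed.

(** The convergence of the sum of [n ^ (-5/4)] by comparison with the increments of
    [n ^ (-1/4)], in terms of two consecutive fourth roots [a] and [b]. *)
Lemma telescope_pow5 (a b : R) : 0 < a -> a <= b -> b ^+ 4 = a ^+ 4 + 1 ->
  b ^- 5 <= 4 * (a^-1 - b^-1).
Proof.
move=> a0 ab e; have b0 : 0 < b by apply: lt_le_trans ab.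
have f : (b - a) * ((a + b) * (a ^+ 2 + b ^+ 2)) = 1.
  by rewrite -[RHS](addrK (a ^+ 4)) [1 + _]addrC -e; ring.
have -> : 4 * (a^-1 - b^-1) = 4 * (b - a) / (a * b).
  by field; rewrite !gt_eqF.
rewrite ler_pdivlMr ?mulr_gt0// mulrC ler_pdivrMr ?exprn_gt0//.
have h1 : (a + b) * (a ^+ 2 + b ^+ 2) <= 4 * b ^+ 3.
  have h2 : a ^+ 2 <= b ^+ 2 by rewrite ler_sqr// nnegrE ltW.
  apply: (@le_trans _ _ ((2 * b) * (2 * b ^+ 2))).
    by apply: ler_pM; [lra|rewrite addr_ge0 ?sqr_ge0|lra|lra].
  by rewrite le_eqVlt; apply/orP; left; apply/eqP; ring.
have h3 : 1 <= (b - a) * (4 * b ^+ 3) by rewrite -[leLHS]f ler_wpM2l// subr_ge0.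
have h4 : a * b <= b ^+ 2 by rewrite expr2 ler_wpM2r// ltW.
apply: le_trans h4 _.
have := ler_wpM2l (sqr_ge0 b) h3; rewrite mulr1 => /le_trans; apply.
by rewrite le_eqVlt; apply/orP; left; apply/eqP; ring.
Qed.

Lemma sum_le_nat (f : nat -> R) M : (forall n : nat, 0 <= f n) ->
  (forall N, \sum_(i < N) f i <= M) -> sum_le f M.
Proof.
move=> f0 h A; pose N := (\max_(i <- A) i)%N.+1.
apply: le_trans (h N); rewrite -(big_mkord xpredT) /index_iota subn0.
pose B := [fset i in iota 0 N]%fset.
have -> : \sum_(i <- iota 0 N) f i = \sum_(i <- B) f i.
  apply/perm_big/uniq_perm; rewrite ?iota_uniq ?fset_uniq// => i.
  by rewrite !inE.
apply: ler_sum_fsubset => //; apply/fsubsetP => n nA.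
have := @leq_bigmax_seq _ (enum_fset A) xpredT id n nA isT.
by rewrite -ltnS -/N => nN; rewrite in_fset mem_iota.
Qed.

Lemma sum_le_int (f : nat -> R) M : (forall n : nat, 0 <= f n) -> sum_le f M ->
  sum_le (fun n : int => f `|n|%N) (M + M).
Proof.
move=> f0 fM A; rewrite (big_fsetID _ (fun n : int => 0 <= n))/=.
have aux (B : {fset int}) : {in B &, injective absz} ->
    \sum_(n <- B) f `|n|%N <= M.
  move=> inj; have := fM [fset `|n|%N | n in B]%fset.
  by rewrite big_imfset.
by apply: lerD; apply: aux => m n; rewrite !inE /=; lia.
Qed.

Lemma sum_rt_pow5 : sum_le (fun n => rt n ^- 5) 10.
Proof.
have e n : rt n ^- 5 = rt `|n|%N ^- 5.
  rewrite /rt /wt -!intr_norm; congr (Num.sqrt (Num.sqrt (1 + _%:~R)) ^- 5).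
have := @sum_le_int (fun n : nat => rt n ^- 5) 5.
rewrite (_ : 5 + 5 = 10 :> R); last by lra.
move=> h A; rewrite (eq_bigr (fun n => rt `|n|%N ^- 5)) => [|n _]; last exact: e.
apply: h A => [n|]; first by rewrite invr_ge0 exprn_ge0// ltW// rt_gt0.
apply: sum_le_nat => [n|N]; first by rewrite invr_ge0 exprn_ge0// ltW// rt_gt0.
have wtS (n : nat) : wt n.+1 = wt n + 1.
  by rewrite /wt !normr_nat -addn1 natrD addrA.
(* the term of index 0 is 1, and the others telescope to [4 * (1 - 1 / rt N)] *)
suff : \sum_(n < N.+1) rt n ^- 5 <= 5 - 4 / rt N.
  rewrite big_ord_recr/=; have := rt_gt0 N => r0.
  have : 0 <= rt N ^- 5 by rewrite invr_ge0 exprn_ge0// ltW.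
  have : 0 <= 4 / rt N by rewrite divr_ge0// ltW.
  lra.
elim: N => [|N IH].
  rewrite big_ord1 /rt /wt normr0 addr0 !sqrtr1 expr1n invr1 mulr1; lra.
rewrite big_ord_recr/=; have t := @telescope_pow5 (rt N) (rt N.+1) (rt_gt0 _).
have {t} := t _ _; rewrite !rt_pow4 wtS => t.
have : rt N <= rt N.+1 by rewrite !ler_wsqrtr// wtS lerDl.
by move=> /t /(_ erefl) h; move: IH h; lra.
Qed.

Lemma sum_wt_sqr : sum_le (fun n => wt n ^- 2) 10.
Proof.
apply: sum_le_mono sum_rt_pow5 => n; rewrite -rt_pow4 -exprM.
by rewrite lef_pV2 ?posrE ?exprn_gt0 ?rt_gt0// ler_weXn2l// rt_ge1.
Qed.

Lemma wt_split k (x : R) : wt k <= (1 + `|x - k%:~R|) * (1 + `|x|).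
Proof.
rewrite /wt; have := ler_normB x (x - k%:~R); rewrite opprB addrC subrK => h.
apply: (@le_trans _ _ (1 + (`|x| + `|x - k%:~R|))); first by rewrite lerD2l.
rewrite mulrDl mul1r mulrDr mulr1.
have : 0 <= `|x - k%:~R| * `|x| by rewrite mulr_ge0.
lra.
Qed.

Lemma inv_le_wt n : n != 0 -> `|n%:~R|^-1 <= 2 / wt n.
Proof.
move=> n0; have n1 : 1 <= `|n%:~R| :> R.
  by rewrite -intr_norm (_ : 1 = 1%:~R)// ler_int; lia.
rewrite ler_pdivlMr ?wt_gt0// ler_pdivrMl; last by lra.
by rewrite /wt; lra.
Qed.

(** Weights [|n| ^ (3/4)] are distributed on the two factors so that, after the
    inequality between arithmetic and geometric means, [c j ^ 2] is multiplied
    by a family summable in [k] uniformly in [j], and the rest is summable in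
    both variables; both rest on the convergence of the sum of [|n| ^ (-5/4)]. *)
Lemma double_sum_le (c : int -> R) M : sum_le (fun j => c j ^+ 2) M ->
  sum_le (fun p : int * int => `|c p.2| / (wt (2 * p.1 - p.2) * wt p.1))
    (M * 10 + (M * 10 + 100)).
Proof.
move=> cM; pose r n : R := rt n ^- 5.
have r0 n : 0 <= r n by rewrite invr_ge0 exprn_ge0// ltW// rt_gt0.
have rM : sum_le r 10 := sum_rt_pow5.
have pt (k j : int) : `|c j| / (wt (2 * k - j) * wt k) <=
    c j ^+ 2 * r (2 * k - j) + (c j ^+ 2 * r k + r k * r (2 * k - j)).
  rewrite -(rt_pow4 k) -(rt_pow4 (2 * k - j)) /r -[c j ^+ 2]real_normK ?num_real//.
  have := rt_ge1 k; have := rt_ge1 (2 * k - j).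
  move: (rt k) (rt (2 * k - j)) `|c j| (normr_ge0 (c j)) => u v d d0 v1 u1.
  pose s := u^-1; pose t := v^-1.
  have s0 : 0 <= s by rewrite invr_ge0; lra.
  have t0 : 0 <= t by rewrite invr_ge0; lra.
  have s1 : s <= 1 by rewrite invf_le1; lra.
  have t1 : t <= 1 by rewrite invf_le1; lra.
  have -> : d / (v ^+ 4 * u ^+ 4) = d * (t ^+ 4 * s ^+ 4).
    by rewrite invfM !exprVn.
  rewrite -!exprVn -/s -/t.
  have e1 : 0 <= t ^+ 3 * s ^+ 3 * (d - t * s) ^+ 2.
    by rewrite mulr_ge0 ?sqr_ge0// mulr_ge0 ?exprn_ge0.
  have e2 : 0 <= d ^+ 2 * (t ^+ 3 - s ^+ 3) ^+ 2 by rewrite mulr_ge0 ?sqr_ge0.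
  have e3 (y : R) : 0 <= y -> y <= 1 -> d ^+ 2 * y ^+ 6 <= d ^+ 2 * y ^+ 5.
    move=> y0 y1; rewrite ler_wpM2l ?sqr_ge0// exprS.
    by rewrite ler_piMl// exprn_ge0.
  have e4 := e3 _ s0 s1; have e5 := e3 _ t0 t1.
  have e6 : 0 <= s ^+ 5 * t ^+ 5 by rewrite mulr_ge0 ?exprn_ge0.
  have -> : d * (t ^+ 4 * s ^+ 4) = (d ^+ 2 * t ^+ 3 * s ^+ 3 + s ^+ 5 * t ^+ 5
      - t ^+ 3 * s ^+ 3 * (d - t * s) ^+ 2) / 2 by field.
  have e7 : d ^+ 2 * t ^+ 3 * s ^+ 3 = (d ^+ 2 * t ^+ 6 + d ^+ 2 * s ^+ 6
      - d ^+ 2 * (t ^+ 3 - s ^+ 3) ^+ 2) / 2 by field.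
  rewrite e7; have e8 : 0 <= d ^+ 2 * t ^+ 5 by rewrite mulr_ge0 ?exprn_ge0.
  have e9 : 0 <= d ^+ 2 * s ^+ 5 by rewrite mulr_ge0 ?exprn_ge0.
  lra.
have c0 j : 0 <= c j ^+ 2 by rewrite sqr_ge0.
apply: (sum_le_mono (fun p => pt p.1 p.2)).
pose sw (p : int * int) := (p.2, p.1).
have inj_sw : injective sw by move=> [? ?] [? ?] [-> ->].
apply: sum_leD; last apply: sum_leD.
- have h := @sum_le_pair R int int (fun j k => c j ^+ 2 * r (2 * k - j))
    (fun j => c j ^+ 2 * 10) (M * 10).
  have {}h : sum_le (fun p : int * int => c p.1 ^+ 2 * r (2 * p.2 - p.1)) (M * 10).
    apply: h => [j k|j|]; first by rewrite mulr_ge0.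
      apply: sum_leZ => //; apply: (sum_le_inj (phi := fun k => 2 * k - j)) rM.
      by move=> k l; lia.
    by rewrite [M * _]mulrC; apply: sum_le_mono (sum_leZ (ler0n _ 10) cM) => j;
      rewrite mulrC.
  exact: (sum_le_inj inj_sw h).
- have h := @sum_le_pair R int int (fun j k => c j ^+ 2 * r k)
    (fun j => c j ^+ 2 * 10) (M * 10).
  have {}h : sum_le (fun p : int * int => c p.1 ^+ 2 * r p.2) (M * 10).
    apply: h => [j k|j|]; first by rewrite mulr_ge0.
      exact: sum_leZ.
    by rewrite [M * _]mulrC; apply: sum_le_mono (sum_leZ (ler0n _ 10) cM) => j;
      rewrite mulrC.
  exact: (sum_le_inj inj_sw h).
- apply: (@sum_le_pair R int int (fun k j => r k * r (2 * k - j)) (fun k => r k * 10)).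
  + by move=> k j; rewrite mulr_ge0.
  + move=> k; apply: sum_leZ => //; apply: (sum_le_inj (phi := fun j => 2 * k - j)) rM.
    by move=> i j; lia.
  + rewrite (_ : 100 = 10 * 10 :> R); last by lra.
    by apply: sum_le_mono (sum_leZ (ler0n _ 10) rM) => j; rewrite mulrC.
Qed.

End Weights.

(** * The interpolation formula *)

Section InterpolationKernel.
Context {R : realType}.
Implicit Types (n k j m : int) (x z : R).
Local Open Scope complex_scope.

(** Entire form of [4 * sin (pi * x / 2) ^+ 2 / (pi ^+ 2 * (x - 2 * k))]. *)
Definition kernel x k : R := 2 * (x / 2 - k%:~R) * sinc (x / 2 - k%:~R) ^+ 2.

(** The coefficient of [a j] in the [k]-th term of the interpolation formula, once
    [b_coef a (2 * k)] has been expanded. *)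
Definition interp_coef x k j : R :=
  if j == 2 * k then sinc (x / 2 - k%:~R) ^+ 2
  else (-1) ^ j * kernel x k / (2 * k - j)%:~R.

Lemma sinc_le_wt x k : `|sinc (x / 2 - k%:~R)| <= 2 * (1 + `|x|) / wt k.
Proof.
rewrite ler_pdivlMr ?wt_gt0//; have h := sinc_decay (x / 2 - k%:~R).
have := wt_split k (x / 2); move: h.
set t := `|sinc _|; set y := `|_ - _| => h hw.
have t0 : 0 <= t := normr_ge0 _.
have x2 : `|x / 2| <= `|x|.
  by rewrite normrM (@ger0_norm _ 2^-1) ?invr_ge0// ler_piMr//; lra.
have y0 : 0 <= y := normr_ge0 _.
apply: (@le_trans _ _ (t * ((1 + y) * (1 + `|x|)))).
  rewrite ler_wpM2l//; apply: le_trans hw _.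
  by rewrite ler_wpM2l ?addr_ge0// lerD2l.
rewrite mulrA ler_wpM2r ?addr_ge0//.
by rewrite mulrC.
Qed.

Lemma kernel_le x k : `|kernel x k| <= 4 * (1 + `|x|) / wt k.
Proof.
rewrite (_ : kernel x k = 2 * ((x / 2 - k%:~R) * sinc (x / 2 - k%:~R)) *
  sinc (x / 2 - k%:~R)); last by rewrite /kernel; ring.
rewrite !normrM; have := mul_sinc_le1 (x / 2 - k%:~R); rewrite normrM.
have := sinc_le_wt x k; set t := `|sinc _|; set y := `|_ - _|.
move=> h1 h2; rewrite (@ger0_norm _ 2)//.
have t0 : 0 <= t := normr_ge0 _.
apply: (@le_trans _ _ (2 * 1 * t)).
  by rewrite ler_wpM2r// ler_wpM2l.
have -> : 4 * (1 + `|x|) / wt k = 2 * (2 * (1 + `|x|) / wt k) by ring.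
by rewrite mulr1 ler_wpM2l.
Qed.

Lemma interp_coef_le x k j :
  `|interp_coef x k j| <= 8 * (1 + `|x|) / (wt (2 * k - j) * wt k).
Proof.
have x1 : 0 <= 1 + `|x| by rewrite addr_ge0.
rewrite /interp_coef; case: eqP => [->|/eqP jk].
  rewrite subrr {1}/wt normr0 addr0 mul1r normrX expr2.
  have h := sinc_le_wt x k; have h1 := sinc_le1 (x / 2 - k%:~R).
  apply: (@le_trans _ _ (1 * (2 * (1 + `|x|) / wt k))).
    by apply: ler_pM.
  by rewrite mul1r ler_pM2r ?invr_gt0 ?wt_gt0// ler_wpM2r//; lra.
have n0 : 2 * k - j != 0 by rewrite subr_eq0 eq_sym.
rewrite normrM normfV normrM norm_signz mul1r.
have -> : 8 * (1 + `|x|) / (wt (2 * k - j) * wt k) =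
    (4 * (1 + `|x|) / wt k) * (2 / wt (2 * k - j)) :> R.
  by field; rewrite !gt_eqF ?wt_gt0.
by apply: ler_pM; rewrite ?invr_ge0//; [exact: kernel_le|exact: inv_le_wt].
Qed.

Lemma pi_sinc_shift z k :
  pi * (z - k%:~R) * sinc (z - k%:~R) = (-1) ^ k * sin (pi * z).
Proof. by rewrite mul_sinc (sin_cos_shift z k).1. Qed.

Lemma even_or_odd j : exists m, j = 2 * m \/ j = 2 * m + 1.
Proof. exists (j %/ 2)%Z; lia. Qed.

Lemma sign_even m : (-1 : R) ^ (2 * m) = 1.
Proof.
rewrite (_ : 2 * m = m + m); last by lia.
by rewrite exprzDr ?unitrN1// sqr_signz.
Qed.

Lemma cos_half_odd m : cos (pi * ((2 * m + 1)%:~R / 2 : R)) = 0.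
Proof.
have [_] := sin_cos_shift (2^-1 : R) (- m).
rewrite (_ : 2^-1 - (- m)%:~R = (2 * m + 1)%:~R / 2); last first.
  by rewrite intrD intrM mulrNz; field.
by move=> ->; rewrite cos_pihalf mulr0.
Qed.

(** Since [cos (pi * j / 2) = 0] for odd [j], the coefficient is a multiple of
    [sinc (x / 2 - k) * sinc (j / 2 - k)]. *)
Lemma interp_coef_odd x m :
  sums (fun k => (interp_coef x k (2 * m + 1))%:C) (sinc (x - (2 * m + 1)%:~R))%:C.
Proof.
pose y : R := (2 * m + 1)%:~R / 2; pose z := x / 2.
have cy : cos (pi * y) = 0 by exact: cos_half_odd.
have sy : sin (pi * y) ^+ 2 = 1 by rewrite sin2cos2 cy expr0n subr0.
have -> : sinc (x - (2 * m + 1)%:~R) =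
    sin (pi * z) * sin (pi * y) * sinc (z - y).
  rewrite (_ : x - _ = 2 * (z - y)); last by rewrite /z /y; field.
  by rewrite sinc_double mulrBr cosB cy mulr0 add0r mulrC.
rewrite rmorphM; apply: sums_ext (sumsZ _ (sinc_reproducing z y)) => k.
rewrite -rmorphM; congr (_ %:C); rewrite /interp_coef ifF; last by apply/eqP; lia.
rewrite exprzDr ?unitrN1// sign_even mul1r expr1z /kernel -/z.
have -> : (2 * k - (2 * m + 1))%:~R = - 2 * (y - k%:~R) :> R.
  by rewrite /y !(intrD, mulrNz, intrM); field.
have yk : y - k%:~R != 0.
  have : (2 * m + 1 - 2 * k)%:~R != 0 :> R by rewrite intr_eq0; lia.
  have -> : (2 * m + 1 - 2 * k)%:~R = 2 * (y - k%:~R) :> R.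
    by rewrite /y !(intrD, mulrNz, intrM); field.
  by apply: contra_neq => ->; rewrite mulr0.
have hz := pi_sinc_shift z k; have hy := pi_sinc_shift y k.
have e2 := sqr_signz (R := R) k.
have pi0 : pi != 0 :> R by rewrite gt_eqF// pi_gt0.
move: hz hy; set e := (-1) ^ k in e2 *; rewrite -/e in e2.
set s := sin (pi * z); set sg := sin (pi * y) in sy *.
set sz := sinc (z - _); set sy' := sinc (y - _).
move=> hz hy.
have -> : s = e * (pi * (z - k%:~R) * sz) by rewrite hz mulrA e2 mul1r.
apply: (mulfI yk); apply: (mulfI pi0); apply/esym.
transitivity (pi * (z - k%:~R) * sz ^+ 2).
  by move: (y - k%:~R) yk (z - k%:~R) (sz) (@pi R) => w w0 u t q; field.
transitivity (e * (pi * (z - k%:~R) * sz) * sg * sz * (pi * (y - k%:~R) * sy')).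
  rewrite hy; transitivity (pi * (z - k%:~R) * sz ^+ 2 * (e * e) * (sg ^+ 2)).
    by rewrite e2 sy !mulr1.
  by ring.
by ring.
Qed.

(** Exchanging [m + k] and [m - k], the nonsymmetric coefficients
    [1 / (k * (z - k))] average to [1 / (z ^+ 2 - k ^+ 2)], which is again an
    instance of the reproducing formula, at the points [z] and [- z]. *)
Lemma interp_coef_even x m :
  sums (fun k => (interp_coef x k (2 * m))%:C) (sinc (x - (2 * m)%:~R))%:C.
Proof.
pose z := x / 2 - m%:~R.
pose e k := interp_coef x (m + k) (2 * m).
have x1 : 0 <= 8 * (1 + `|x|) by rewrite mulr_ge0// addr_ge0.
have inj : injective (fun k => 2 * k - 2 * m) by move=> k l; lia.
have [S hS0] : exists S, sums (fun k => (interp_coef x k (2 * m))%:C) S.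
  apply: sums_normal (sum_leZ x1 (sum_leD (sum_le_inj inj sum_wt_sqr) sum_wt_sqr)) => k.
  rewrite normc_real; apply: le_trans (interp_coef_le x k (2 * m)) _.
  rewrite ler_wpM2l// invfM -!exprVn.
  move: (wt _)^-1 (wt k)^-1 => u v.
  have := sqr_ge0 (u - v); have := sqr_ge0 u; have := sqr_ge0 v; nra.
suff <- : S = (sinc (x - (2 * m)%:~R))%:C by [].
have hS : sums (fun k => (e k)%:C) S.
  by apply: (sums_reindex (phi := fun k => m + k) (psi := fun k => k - m)) hS0 => k; lia.
have hS' : sums (fun k => (e (- k))%:C) S.
  by apply: (sums_reindex (phi := -%R) (psi := -%R)) hS; exact: opprK.
have hK : sums (fun k => (2^-1)%:C * ((e k)%:C + (e (- k))%:C)) (sinc (x - (2 * m)%:~R))%:C.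
  have -> : x - (2 * m)%:~R = z - (- z) by rewrite /z intrM; field.
  apply: sums_ext (sinc_reproducing z (- z)) => k.
  rewrite -!(rmorphD, rmorphM); congr (_ %:C).
  rewrite /e /interp_coef /kernel !sign_even.
  have -> : x / 2 - (m + k)%:~R = z - k%:~R by rewrite /z intrD; ring.
  have -> : x / 2 - (m - k)%:~R = z + k%:~R by rewrite /z intrB; ring.
  rewrite -opprD sincN.
  have [->|k0] := eqVneq k 0.
    by rewrite mulr0z !addr0 !subr0 !eqxx; field.
  rewrite !ifF; [|by apply/eqP; lia|by apply/eqP; lia].
  have -> : (2 * (m + k) - 2 * m)%:~R = 2 * k%:~R :> R.
    by rewrite (_ : _ - _ = 2 * k) ?intrM//; lia.
  have -> : (2 * (m - k) - 2 * m)%:~R = - (2 * k%:~R) :> R.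
    by rewrite (_ : _ - _ = - (2 * k)) ?mulrNz ?intrM//; lia.
  have hm := pi_sinc_shift z k; have hp := pi_sinc_shift z (- k).
  have sgn : (-1 : R) ^ (- k) = (-1) ^ k.
    by rewrite -exprz_inv invrN invr1.
  rewrite mulrNz opprK sgn in hp.
  have kR0 : k%:~R != 0 :> R by rewrite intr_eq0.
  have pi0 : pi != 0 :> R by rewrite gt_eqF// pi_gt0.
  set s1 := sinc (z - _) in hm *; set s2 := sinc (z + _) in hp *.
  apply: (mulfI kR0); apply: (mulfI pi0); apply: (@mulfI _ 2) => //.
  transitivity ((pi * (z + k%:~R) * s2) * s1 - (pi * (z - k%:~R) * s1) * s2).
    by ring.
  rewrite hp -hm; transitivity (pi * (z - k%:~R) * s1 * s1 - (-1) ^ k * sin (pi * z) * s2).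
    by rewrite hm.
  rewrite -hp.
  by move: (k%:~R) kR0 (@pi R) => w w0 q; field.
have := sums_unique (sumsZ (2^-1)%:C (sumsD hS hS')) hK => <-.
by rewrite fmorphV/= rmorph_nat; field.
Qed.

Lemma interp_coef_sums x j :
  sums (fun k => (interp_coef x k j)%:C) (sinc (x - j%:~R))%:C.
Proof.
have [m [->|->]] := even_or_odd j; [exact: interp_coef_even|exact: interp_coef_odd].
Qed.

End InterpolationKernel.

Section Interpolation.
Context {R : realType}.
Implicit Types (a : int -> R[i]) (n k j m : int) (x z : R).
Local Open Scope complex_scope.

Lemma ell2_sum_le a : ell2 a -> exists M, sum_le (fun n => normc (a n) ^+ 2) M.
Proof.
rewrite /ell2 summableE; set E := esum _ _ => /fineK EE; exists (fine E) => A.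
rewrite -lee_fin EE -sumEFin; apply: esum_ge; exists [set` A].
  by split=> //; exact: finite_fset.
rewrite fsbig_finite//= set_fsetK; apply: lee_sum => i _.
by rewrite lee_fin ger0_norm ?sqr_ge0.
Qed.

Lemma cardinal_sums a M x : sum_le (fun n => normc (a n) ^+ 2) M ->
  exists s, sums (cardinal_term a x) s.
Proof.
move=> aM; apply: sums_normal (sum_leD aM (sinc_sqr_sum_le1 x)) => n.
rewrite ComplexField.Normc.normcM normc_real -[sinc _ ^+ 2]real_normK ?num_real//.
have := sqr_ge0 (normc (a n) - `|sinc (x - n%:~R)|).
have := sqr_ge0 (normc (a n)); have := sqr_ge0 `|sinc (x - n%:~R)|; lra.
Qed.

Lemma normc_int n : normc (n%:~R : R[i]) = `|n%:~R|.
Proof. by rewrite -[n%:~R](rmorph_int (real_complex R)) normc_real. Qed.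

Lemma normc_sign n : normc ((-1 : R[i]) ^ n) = 1.
Proof.
have -> : (-1 : R[i]) ^ n = ((-1) ^ n)%:C.
  by rewrite rmorphXz/= ?rmorphN1// unitrN1.
by rewrite normc_real norm_signz.
Qed.

Lemma b_term_sums a M k : sum_le (fun n => normc (a n) ^+ 2) M ->
  exists s, sums (b_term a k) s.
Proof.
move=> aM.
have inj : injective (fun j => k - j) by move=> i j; lia.
apply: sums_normal (sum_leD aM (sum_le_inj inj sum_wt_sqr)) => j.
rewrite /b_term; case: eqP => [_|/eqP jk].
  by rewrite ComplexField.Normc.normc0 addr_ge0 ?sqr_ge0 ?invr_ge0 ?exprn_ge0 ?(ltW (wt_gt0 _)).
rewrite !ComplexField.Normc.normcM normc_sign mulr1 ComplexField.Normc.normcV normc_int.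
have kj : k - j != 0 by rewrite subr_eq0 eq_sym.
have := @inv_le_wt R _ kj; rewrite -exprVn.
move: (wt _)^-1 (`|_|^-1) (normc_ge0 (a j)) => u v a0 vu.
apply: (@le_trans _ _ (normc (a j) * (2 * u))); first by rewrite ler_wpM2l.
by have := sqr_ge0 (normc (a j) - u); lra.
Qed.

Lemma interp_rawE a k x : x != (2 * k)%:~R ->
  interp_raw a k x = a (2 * k) * (sinc (x / 2 - k%:~R) ^+ 2)%:C +
                     b_coef a (2 * k) * (kernel x k)%:C.
Proof.
move=> xk; have t0 : x - (2 * k)%:~R != 0 by rewrite subr_eq0.
have te : x / 2 - k%:~R = (x - (2 * k)%:~R) / 2 by rewrite intrM; field.
have pi0 : pi != 0 :> R by rewrite gt_eqF// pi_gt0.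
have e1 : sinc (x / 2 - k%:~R) ^+ 2 =
    4 * sin (2^-1 * pi * x) ^+ 2 / pi ^+ 2 * (x - (2 * k)%:~R) ^- 2.
  have := pi_sinc_shift (x / 2) k; rewrite te.
  rewrite (_ : pi * (x / 2) = 2^-1 * pi * x); last by ring.
  move: (x - _) t0 => t t0 /(congr1 (fun y => y ^+ 2)).
  rewrite [RHS]exprMn [((-1) ^ k) ^+ 2]expr2 sqr_signz mul1r => <-.
  by move: (sinc _) (@pi R) pi0 => s q q0; field; rewrite t0 q0.
have e2 : kernel x k =
    4 * sin (2^-1 * pi * x) ^+ 2 / pi ^+ 2 * (x - (2 * k)%:~R)^-1.
  rewrite /kernel e1 te; move: (x - _) t0 => t t0.
  by move: (@pi R) pi0 (sin _) => q q0 s; field; rewrite t0 q0.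
rewrite e1 e2 /interp_raw mulrDr; move: (4 * _ / _) => c.
by rewrite !rmorphM !fmorphV !rmorphXn/=; congr (_ + _); ring.
Qed.

(** Both sides agree off [2 * k] by [interp_rawE], and at [2 * k] the right-hand side
    is the limit: [sinc_defect] bounds the difference by a multiple of the distance
    to [2 * k]. *)
Lemma interp_termE a k x :
  interp_term a k x = a (2 * k) * (sinc (x / 2 - k%:~R) ^+ 2)%:C +
                      b_coef a (2 * k) * (kernel x k)%:C.
Proof.
rewrite /interp_term /extend_at; case: eqP => [->|/eqP]; last exact: interp_rawE.
have k0 : (2 * k)%:~R / 2 - k%:~R = 0 :> R by rewrite intrM; field.
rewrite k0 sinc0 expr1n mulr1 /kernel k0 mulr0 mul0r mulr0 addr0.
apply: (@cvg_lim R[i]^o); first exact: norm_hausdorff.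
apply/cvgrPdist_lt => e e0.
have eE : e = (complex.Re e)%:C.
  by move: e0; rewrite ltcE/= => /andP[/eqP]; case: e => p q /= ->.
have e0R : 0 < complex.Re e by rewrite -ltcR -eE.
set A := normc (a (2 * k)); set B := normc (b_coef a (2 * k)).
have A0 : 0 <= A := normc_ge0 _.
have B0 : 0 <= B := normc_ge0 _.
have p0 := @pi_gt0 R.
pose D := A * pi + 2 * B + 1.
have D0 : 0 < D by rewrite ltr_wpDl// addr_ge0// mulr_ge0// ltW.
have d0 : 0 < Num.min 1 (complex.Re e / D) by rewrite lt_min ltr01 divr_gt0.
near=> y.
have yk : y != (2 * k)%:~R by near: y; exact: nbhs_dnbhs_neq.
have yd : `|y - (2 * k)%:~R| < Num.min 1 (complex.Re e / D).
  rewrite distrC; near: y; apply: nbhs_dnbhs; exact: nbhsx_ballx.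
rewrite interp_rawE// eE normc_def ltcR.
suff : normc (a (2 * k) - (a (2 * k) * (sinc (y / 2 - k%:~R) ^+ 2)%:C +
    b_coef a (2 * k) * (kernel y k)%:C)) < complex.Re e by case: (_ - _).
move: yd; rewrite lt_min => /andP[y1 ye].
pose t := y / 2 - k%:~R.
have yt : `|y - (2 * k)%:~R| = 2 * `|t|.
  transitivity `|2 * t|; last by rewrite normrM ger0_norm.
  by congr `|_|; rewrite /t intrM; field.
rewrite {}yt in y1 ye.
have t2 : `|t| <= 2^-1 by lra.
have [s1 s2] : 1 - sinc t ^+ 2 <= pi * `|t| /\ 0 <= 1 - sinc t ^+ 2.
  split; last by rewrite subr_ge0 -[sinc t ^+ 2]real_normK ?num_real// expr_le1// sinc_le1.
  apply: le_trans (sinc_defect t2) _; rewrite -[sin _ ^+ 2]real_normK ?num_real//.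
  apply: (@le_trans _ _ `|sin (pi * t)|).
    by rewrite expr2 ler_piMl// sin_max.
  rewrite -mul_sinc normrM [X in X * _]normrM (gtr0_norm p0) ler_piMr ?sinc_le1//.
  by rewrite mulr_ge0// ltW.
have s3 : `|kernel y k| <= 2 * `|t|.
  rewrite /kernel -/t normrM [X in X * _]normrM ger0_norm// ler_piMr ?mulr_ge0//.
  by rewrite normrX exprn_ile1// sinc_le1.
rewrite (_ : _ - _ = a (2 * k) * (1 - sinc t ^+ 2)%:C - b_coef a (2 * k) * (kernel y k)%:C);
  last by rewrite rmorphB rmorph1 /t; ring.
apply: le_lt_trans (normcB _ _) _; rewrite !ComplexField.Normc.normcM !normc_real.
rewrite -/A -/B (ger0_norm s2).
apply: (@le_lt_trans _ _ (D * `|t|)).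
  apply: (@le_trans _ _ (A * (pi * `|t|) + B * (2 * `|t|))).
    by rewrite lerD// ler_wpM2l.
  by rewrite /D; have : 0 <= `|t| := normr_ge0 _; lra.
apply: (@le_lt_trans _ _ (D * (2 * `|t|))).
  by rewrite ler_wpM2l ?(ltW D0)//; have : 0 <= `|t| := normr_ge0 _; lra.
by rewrite mulrC -ltr_pdivlMr.
Unshelve. all: by end_near.
Qed.

Lemma interp_row_sums a M x k : sum_le (fun n => normc (a n) ^+ 2) M ->
  sums (fun j => a j * (interp_coef x k j)%:C) (interp_term a k x).
Proof.
move=> aM; rewrite interp_termE.
have [s0 hs0] := b_term_sums (2 * k) aM.
have hb : sums (b_term a (2 * k)) (b_coef a (2 * k)) := sums_zsumP hs0.
pose d j := if j == 2 * k then a j * (sinc (x / 2 - k%:~R) ^+ 2)%:C else 0.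
have hd : sums d (a (2 * k) * (sinc (x / 2 - k%:~R) ^+ 2)%:C).
  have e : d (2 * k) = a (2 * k) * (sinc (x / 2 - k%:~R) ^+ 2)%:C by rewrite /d eqxx.
  rewrite -e -(@big_seq_fset1 _ 0 +%R int (2 * k) d); apply: sums_finite => j.
  by rewrite inE /d => /negbTE ->.
rewrite [b_coef _ _ * _]mulrC.
apply: sums_ext (sumsD hd (sumsZ (kernel x k)%:C hb)) => j.
  rewrite /d /b_term /interp_coef; case: eqP => [_|/eqP jk].
    by rewrite mulr0 addr0.
have kj : (2 * k - j)%:~R != 0 :> R by rewrite intr_eq0 subr_eq0 eq_sym.
have sg : (-1 : R[i]) ^ (2 * k - j) = ((-1) ^ j)%:C.
  rewrite rmorphXz/= ?rmorphN1 ?unitrN1// exprzDr ?unitrN1//.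
  rewrite -exprz_inv invrN invr1.
  have -> : (-1 : R[i]) ^ (2 * k) = 1.
    rewrite (_ : 2 * k = k + k); last by lia.
    by rewrite exprzDr ?unitrN1// -expfzMl mulrNN mulr1 exp1rz.
  by rewrite mul1r.
rewrite add0r sg !rmorphM fmorphV rmorph_int/=; ring.
Qed.

(** In the bound of [interp_coef_le] the point [x] only enters through the factor
    [8 * (1 + |x|)]; the sums over [j] of the rest form the family [r]. *)
Lemma interp_dominated a M : sum_le (fun n => normc (a n) ^+ 2) M ->
  exists r : int -> R, exists M',
    [/\ sum_le r M', forall k, 0 <= r k &
        forall x k, normc (interp_term a k x) <= 8 * (1 + `|x|) * r k].
Proof.
move=> aM; have := double_sum_le aM; set M' := _ + _ => TM.
pose T k j := `|normc (a j)| / (wt (2 * k - j) * wt k).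
have T0 k j : 0 <= T k j by rewrite divr_ge0// mulr_ge0// ltW// wt_gt0.
have inj k : injective (fun j : int => (k, j)) by move=> i j [].
have /choice[r hr] k : exists s : R, sums (fun j => (T k j)%:C) s%:C.
  exact: (nonneg_sums (T0 k) (sum_le_inj (inj k) TM)).
have [s hs] := nonneg_sums (fun p : int * int => T0 p.1 p.2) TM.
have r0 k : 0 <= r k := sum_le_ge0 (nonneg_sum_le (T0 k) (hr k)).
exists r, s; split=> //; first exact: nonneg_sum_le r0 (sums_fubini hs hr).
move=> x k.
have x0 : 0 <= 8 * (1 + `|x|) by rewrite mulr_ge0// addr_ge0.
apply: sums_norm_le (interp_row_sums x k aM) _
  (sum_leZ x0 (nonneg_sum_le (T0 k) (hr k))) => j.
rewrite ComplexField.Normc.normcM normc_real /T (ger0_norm (normc_ge0 _)).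
rewrite mulrCA mulrA -[leRHS]mulrA ler_wpM2l ?normc_ge0//.
exact: interp_coef_le.
Qed.

(** The iterated sums of the double series: over [j] first, the terms of the
    interpolation formula; over [k] first, those of the cardinal series. *)
Lemma interp_sums a M x : sum_le (fun n => normc (a n) ^+ 2) M ->
  sums (fun k => interp_term a k x) (cardinal_series a x).
Proof.
move=> aM; have TM := double_sum_le aM.
have x0 : 0 <= 8 * (1 + `|x|) by rewrite mulr_ge0// addr_ge0.
have [|S hS] := @sums_normal R _ (fun p : int * int => a p.2 * (interp_coef x p.1 p.2)%:C)
    _ _ _ (sum_leZ x0 TM).
  move=> [k j] /=; rewrite ComplexField.Normc.normcM normc_real.
  rewrite (ger0_norm (normc_ge0 _)) mulrCA ler_wpM2l ?normc_ge0//.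
  exact: interp_coef_le.
have h1 := sums_fubini hS (fun k => interp_row_sums x k aM).
have hS' : sums (fun p : int * int => a p.1 * (interp_coef x p.2 p.1)%:C) S.
  by apply: (sums_reindex (phi := fun p => (p.2, p.1)) (psi := fun p => (p.2, p.1))) hS;
     case.
have h2 : sums (cardinal_term a x) S.
  by apply: (sums_fubini hS') => j; apply: sumsZ; exact: interp_coef_sums.
by rewrite /cardinal_series (sums_zsum h2).
Qed.

(** The Weierstrass M-test, on the bounded set [K]. *)
Lemma interp_uniform a M (K : set R) : sum_le (fun n => normc (a n) ^+ 2) M ->
  compact K ->
  {uniform K, interp_partial_sum a @ summability.totally
        --> (cardinal_series a : R -> R[i]^o)}.
Proof.
move=> aM /compact_bounded[B [_ hB]].
have {}hB x : K x -> `|x| <= B + 1 by apply: hB; rewrite ltrDl.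
have [r [M' [rM r0 hr]]] := interp_dominated aM.
pose C := 8 * (1 + (B + 1)).
move=> P /uniform_nbhs[E [entE sub]].
rewrite -entourage_ballE in entE; have [e /= e0 hE] := entE.
have eE : e = (complex.Re e)%:C.
  by move: e0; rewrite ltcE/= => /andP[/eqP]; case: (e) => p q /= ->.
have e0R : 0 < complex.Re e / 2 by rewrite divr_gt0// -ltcR -eE.
have [C0|C0] := ltP 0 C; last first.
  exists fset0 => // A _; apply: sub => x Kx.
  have := hB x Kx; have := normr_ge0 x; move: C0; rewrite /C; lra.
have [A0 hA0] := sum_le_tail (fun k => mulr_ge0 (ltW C0) (r0 k)) (sum_leZ (ltW C0) rM) e0R.
exists A0 => // A A0A; apply: sub => x Kx; apply: hE => /=.
have dom k : normc (interp_term a k x) <= C * r k.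
  by apply: le_trans (hr x k) _; rewrite ler_wpM2r// ler_wpM2l// lerD2l hB.
have := sums_dist_le (interp_sums x aM) dom (fun B h => ltW (hA0 B h)) A0A.
have pE : interp_partial_sum a A x = \sum_(k <- A) interp_term a k x.
  by rewrite big_seq_fsetE.
rewrite -ball_normE/= pE eE normc_def ltcR normc_distC => h.
by apply: (@le_lt_trans _ _ (complex.Re e / 2)); [case: (_ - _) h|lra].
Qed.

End Interpolation.

(** * Integrals on the line *)

Section LineIntegrals.
Context {R : realType}.
Local Notation mu := (@lebesgue_measure R).
Implicit Types (x xi b c n th : R).

Lemma integral_split_reflect (G : R -> R) n : continuous G ->
  (forall x, 0 <= G x) ->
  (\int[mu]_x (G x)%:E = \int[mu]_(x in `[n, +oo[) (G x)%:E +
                         \int[mu]_(x in `[(- n)%R, +oo[) (G (- x)%R)%:E)%E.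
Proof.
move=> cG G0.
have mG (D : set R) : measurable_fun D (fun x => (G x)%:E).
  by apply/measurable_EFinP; apply: measurable_funTS; exact: continuous_measurable_fun.
have -> : [set: R] = `]n, +oo[ `|` `]-oo, n].
  apply/seteqP; split => x //= _; rewrite !in_itv/= andbT.
  by have [] := ltP n x; [left|right].
rewrite ge0_integral_setU//=.
- congr (_ + _)%E; first by rewrite integral_itv_obnd_cbnd.
  rewrite -{1}(opprK n) ge0_integration_by_substitutionNy//.
  exact: continuous_subspaceT.
- exact: mG.
- by move=> x _; rewrite lee_fin.
- apply/disj_setPS => x [] /=; rewrite !in_itv/= andbT => nx xn.
  by have := lt_le_trans nx xn; rewrite ltxx.
Qed.

Lemma cvgy_affine c n : 0 < c -> c * (x - n) @[x --> +oo] --> +oo.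
Proof.
move=> c0; apply/cvgryPge => A; near=> x.
rewrite -ler_pdivrMl// lerBrDr; near: x; apply: nbhs_pinfty_ge; exact: num_real.
Unshelve. all: by end_near. Qed.

Lemma cvgy_expRN c n : 0 < c -> expR (- (c * (x - n))) @[x --> +oo] --> 0.
Proof.
move=> c0; apply: (cvg_comp (fun x => c * (x - n)) (fun x => expR (- x))).
  exact: cvgy_affine.
exact: cvgr_expR.
Qed.

(** Adding 1 to the cosine makes the integrand nonnegative, as the fundamental
    theorem of calculus on a half-line requires. *)
Lemma integral_exp_half c b th n : 0 < c ->
  (\int[mu]_(x in `[n, +oo[) (expR (- (c * (x - n))) * (1 + cos (th + b * x)))%:E =
   (c^-1 + (c * cos (th + b * n) - b * sin (th + b * n)) / (c ^+ 2 + b ^+ 2))%:E)%E.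
Proof.
move=> c0.
have q0 : c ^+ 2 + b ^+ 2 != 0 by rewrite gt_eqF// ltr_pwDl ?exprn_gt0 ?sqr_ge0.
pose g x := (b * sin (th + b * x) - c * cos (th + b * x)) / (c ^+ 2 + b ^+ 2).
pose F x := expR (- (c * (x - n))) * (- c^-1 + g x).
have dF x : is_derive x 1 F (expR (- (c * (x - n))) * (1 + cos (th + b * x))).
  apply: is_derive_eq.
  rewrite /GRing.scale/= !mulr1 ?mulr0 ?addr0 ?add0r ?subr0.
  rewrite /g; move: (cos _) (sin _) (expR _) => C S E.
  by field; rewrite q0 gt_eqF.
have cF x : {for x, continuous F}.
  by apply: differentiable_continuous; apply/derivable1_diffP; case: (dF x).
rewrite (@ge0_continuous_FTC2y _ _ F n 0).
- rewrite /F subrr mulr0 oppr0 expR0 mul1r sub0e -EFinN; congr EFin.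
  by rewrite /g opprD opprK -mulNr opprB.
- by move=> x _; rewrite mulr_ge0 ?expR_ge0// -lerBlDl sub0r cos_geN1.
- apply: continuous_subspaceT => x; apply: cvgM.
    by apply: (@continuous_comp _ _ _ (fun x => - (c * (x - n))) expR);
       [apply: cvgN; apply: cvgM; [exact: cvg_cst|apply: cvgB => //; exact: cvg_cst]|exact: continuous_expR].
  by apply: cvgD; [exact: cvg_cst|exact: continuous_cos_affine].
- pose K := c^-1 + (`|b| + c) / (c ^+ 2 + b ^+ 2).
  have gK x : `|- c^-1 + g x| <= K.
    apply: le_trans (ler_normD _ _) _; rewrite normrN gtr0_norm ?invr_gt0// lerD2l.
    rewrite /g normrM normfV (@gtr0_norm _ (c ^+ 2 + b ^+ 2)); last first.
      by rewrite ltr_pwDl ?exprn_gt0 ?sqr_ge0.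
    rewrite ler_wpM2r ?invr_ge0 ?addr_ge0 ?sqr_ge0//.
    apply: le_trans (ler_normB _ _) _; rewrite !normrM (gtr0_norm c0).
    by rewrite lerD// ler_piMr// ?sin_max ?cos_max// ltW.
  have : expR (- (c * (x - n))) * K @[x --> +oo] --> 0.
    by rewrite -[X in _ --> X](mul0r K); apply: cvgMl; exact: cvgy_expRN.
  move=> hK; apply/cvgr0Pnorm_lt => e e0.
  move/cvgr0Pnorm_lt : hK => /(_ _ e0); apply: filterS => x.
  apply: le_lt_trans; rewrite /F !normrM ler_wpM2l//.
  exact: le_trans (gK x) (ler_norm _).
- by move=> x _; case: (dF x).
- by apply: cvg_at_right_filter; exact: cF.
- by move=> x _; rewrite derive1E; apply: derive_val.
Qed.

Lemma continuous_exp_dist c n : continuous (fun x => expR (- (c * `|x - n|))).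
Proof.
move=> x; apply: (@continuous_comp _ _ _ (fun x => - (c * `|x - n|)) expR).
  apply: cvgN; apply: cvgM; first exact: cvg_cst.
  by apply: cvg_norm; apply: cvgB => //; exact: cvg_cst.
exact: continuous_expR.
Qed.

Lemma integral_exp_cos c b th n : 0 < c ->
  (\int[mu]_x (expR (- (c * `|x - n|)) * (1 + cos (th + b * x)))%:E =
   (2 / c + 2 * c / (c ^+ 2 + b ^+ 2) * cos (th + b * n))%:E)%E.
Proof.
move=> c0; rewrite (@integral_split_reflect _ n).
- transitivity (\int[mu]_(x in `[n, +oo[)
      (expR (- (c * (x - n))) * (1 + cos (th + b * x)))%:E +
    \int[mu]_(x in `[(- n)%R, +oo[)
      (expR (- (c * (x - - n))) * (1 + cos (- th + b * x)))%:E)%E.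
    congr (_ + _)%E; apply: eq_integral => x; rewrite inE/= in_itv/= andbT => nx.
      by rewrite ger0_norm// subr_ge0.
    rewrite -opprB normrN ger0_norm; last by rewrite opprK; lra.
    rewrite -(cosN (_ + b * - x)) opprD mulrN opprK; congr (expR (- (c * _)) * _)%:E.
      by rewrite opprK addrC.
    by rewrite opprK.
  rewrite !integral_exp_half// -EFinD; congr EFin.
  have -> : - th + b * - n = - (th + b * n) by ring.
  by rewrite cosN sinN; ring.
- move=> x; apply: cvgM; first exact: continuous_exp_dist.
  by apply: cvgD; [exact: cvg_cst|exact: continuous_cos_affine].
- by move=> x; rewrite mulr_ge0 ?expR_ge0// -lerBlDl sub0r cos_geN1.
Qed.

Lemma integral_exp_dist c n : 0 < c ->
  (\int[mu]_x (expR (- (c * `|x - n|)))%:E = (2 / c)%:E)%E.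
Proof.
move=> c0; have := @integral_exp_cos c 0 (pi / 2) n c0.
rewrite mul0r addr0 cos_pihalf mulr0 addr0 => <-.
by under [RHS]eq_integral do rewrite mul0r addr0 cos_pihalf addr0 mulr1.
Qed.

Lemma integrable_exp_dist c n : 0 < c ->
  mu.-integrable setT (fun x => (expR (- (c * `|x - n|)))%:E).
Proof.
move=> c0; apply/integrableP; split.
  by apply/measurable_EFinP; apply: continuous_measurable_fun; exact: continuous_exp_dist.
under eq_integral do rewrite gee0_abs ?lee_fin ?expR_ge0//.
by rewrite integral_exp_dist// ltry.
Qed.

Lemma integrable_exp_bounded c n (g : R -> R) : 0 < c -> measurable_fun setT g ->
  (forall x, `|g x| <= 1) ->
  mu.-integrable setT (fun x => (expR (- (c * `|x - n|)) * g x)%:E).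
Proof.
move=> c0 mg g1; apply: le_integrable (integrable_exp_dist n c0) => //.
  apply/measurable_EFinP; apply: measurable_funM => //.
  by apply: continuous_measurable_fun; exact: continuous_exp_dist.
move=> x _; rewrite lee_fin !normrM ger0_norm ?expR_ge0//.
by rewrite ler_piMr ?expR_ge0.
Qed.

Lemma Rintegral_exp_cos c b th n : 0 < c ->
  \int[mu]_x (expR (- (c * `|x - n|)) * cos (th + b * x)) =
  2 * c / (c ^+ 2 + b ^+ 2) * cos (th + b * n).
Proof.
move=> c0; have i1 := integrable_exp_dist n c0.
have i2 := @integrable_exp_bounded c n (fun x => cos (th + b * x)) c0
  (continuous_measurable_fun (@continuous_cos_affine R th b)) (fun x => cos_max _).
have := @integral_exp_cos c b th n c0.
under eq_integral do rewrite mulrDr mulr1.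
move=> /(congr1 fine); rewrite -/(Rintegral _ _ _) RintegralD//=.
rewrite {1}/Rintegral integral_exp_dist//=; lra.
Qed.

End LineIntegrals.

Section Mollifier.
Context {R : realType}.
Local Notation mu := (@lebesgue_measure R).
Implicit Types (x xi b c n th t : R).

(** Integrable majorants of the squared errors made by damping. *)
Definition lorentz c n x : R := (1 + (c * (x - n)) ^+ 2)^-1.

Lemma lorentz_den_gt0 (y : R) : 0 < 1 + y ^+ 2.
Proof. by rewrite ltr_pwDl ?sqr_ge0. Qed.

Lemma continuous_lorentz c n : continuous (lorentz c n).
Proof.
move=> x; apply: cvgV; first by rewrite gt_eqF// lorentz_den_gt0.
apply: cvgD; first exact: cvg_cst.
by apply: cvgM; apply: cvgM; (try exact: cvg_cst); apply: cvgB => //; exact: cvg_cst.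
Qed.

Lemma lorentz_ge0 c n x : 0 <= lorentz c n x.
Proof. by rewrite invr_ge0 ltW// lorentz_den_gt0. Qed.

Lemma integral_lorentz c n : 0 < c ->
  (\int[mu]_x (lorentz c n x)%:E = (pi / c)%:E)%E.
Proof.
move=> c0.
have half m : (\int[mu]_(x in `[m, +oo[) (lorentz c m x)%:E = (pi / 2 / c)%:E)%E.
  pose F x := c^-1 * atan (c * (x - m)).
  have dF x : is_derive x 1 F (lorentz c m x).
    apply: is_derive_eq.
    rewrite /GRing.scale/= /lorentz ?mulr1 ?mulr0 ?addr0 ?add0r ?subr0.
    have := @lorentz_den_gt0 (c * (x - m)); move: (1 + _) => d d0.
    by field; rewrite !gt_eqF.
  have cF x : {for x, continuous F}.
    by apply: differentiable_continuous; apply/derivable1_diffP; case: (dF x).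
  rewrite (@ge0_continuous_FTC2y _ _ F m (c^-1 * (pi / 2))).
  - by rewrite /F subrr mulr0 atan0 mulr0 sube0 mulrC.
  - by move=> x _; exact: lorentz_ge0.
  - by apply: continuous_subspaceT; exact: continuous_lorentz.
  - apply: cvgMr; apply: (cvg_comp (fun x => c * (x - m)) (@atan R)).
      exact: cvgy_affine.
    exact: cvgy_atan.
  - by move=> x _; case: (dF x).
  - by apply: cvg_at_right_filter; exact: cF.
  - by move=> x _; rewrite derive1E; apply: derive_val.
rewrite (@integral_split_reflect _ _ n); last 2 first.
- exact: continuous_lorentz.
- exact: lorentz_ge0.
under [X in (_ + X)%E]eq_integral => x _.
  rewrite (_ : lorentz c n (- x) = lorentz c (- n) x); first over.
  by rewrite /lorentz -opprD mulrN sqrrN opprK.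
by rewrite !half -EFinD; congr EFin; field; rewrite gt_eqF.
Qed.

(** The Fourier transform of [sinc x * expR (- (c * |x|))]: the convolution of
    the indicator of [[-1/2, 1/2]] with a Poisson kernel. *)
Definition smooth_box c xi : R :=
  (atan (2 * pi / c * (xi + 2^-1)) - atan (2 * pi / c * (xi - 2^-1))) / pi.

Lemma continuous_poisson c xi : 0 < c ->
  continuous (fun t => 2 * c / (c ^+ 2 + (2 * pi * (xi + t)) ^+ 2)).
Proof.
move=> c0 t; apply: cvgM; first exact: cvg_cst.
apply: cvgV; first by rewrite gt_eqF// ltr_pwDl ?exprn_gt0 ?sqr_ge0.
apply: cvgD; first exact: cvg_cst.
by apply: cvgM; apply: cvgM; (try exact: cvg_cst); apply: cvgD => //; exact: cvg_cst.
Qed.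

Lemma integral_poisson c xi : 0 < c ->
  \int[mu]_(t in `[- 2^-1, 2^-1]) (2 * c / (c ^+ 2 + (2 * pi * (xi + t)) ^+ 2)) =
  smooth_box c xi.
Proof.
move=> c0; have p0 := @pi_gt0 R.
pose F t := pi^-1 * atan (2 * pi / c * (xi + t)).
have den0 t : 0 < c ^+ 2 + (2 * pi * (xi + t)) ^+ 2.
  by rewrite ltr_pwDl ?exprn_gt0 ?sqr_ge0.
have dF t : is_derive t 1 F (2 * c / (c ^+ 2 + (2 * pi * (xi + t)) ^+ 2)).
  apply: is_derive_eq.
  rewrite /GRing.scale/= ?mulr1 ?mulr0 ?addr0 ?add0r ?subr0.
  have := den0 t; have := lorentz_den_gt0 (2 * pi / c * (xi + t)).
  move: (@pi R) p0 => q q0 h1 h2; field.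
  by rewrite !gt_eqF.
rewrite (FTC_derive _ (@continuous_poisson c xi c0) dF); last by lra.
by rewrite /F /smooth_box; rewrite -mulrBr mulrC.
Qed.

Lemma integral_indic_itv (g : R -> R) (D : set R) :
  (\int[mu]_x (g x * \1_D x)%:E = \int[mu]_(x in D) (g x)%:E)%E.
Proof. by rewrite [RHS]integral_mkcond epatch_indic. Qed.

Lemma EFin_Rintegral (D : set R) (g : R -> R) : measurable D ->
  mu.-integrable D (EFin \o g) ->
  (\int[mu]_(x in D) (g x)%:E = (\int[mu]_(x in D) g x)%:E)%E.
Proof. by move=> mD ig; rewrite /Rintegral fineK// integrable_fin_num. Qed.

Lemma lebesgue_measure_unit_itv : mu `[- 2^-1, 2^-1] = 1%E.
Proof.
by rewrite lebesgue_measure_itv/= lte_fin ifT -?EFinD; [congr EFin|]; lra.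
Qed.

(** [sinc] is the integral of an exponential over [[-1/2, 1/2]]; after exchanging the
    integrals, the inner one is the Fourier transform of [expR (- (c * |x|))], a
    Poisson kernel. *)
Lemma integral_exp_sinc_cos c xi th n : 0 < c ->
  \int[mu]_x (expR (- (c * `|x - n|)) * (sinc (x - n) * cos (th + 2 * pi * xi * x))) =
  cos (th + 2 * pi * xi * n) * smooth_box c xi.
Proof.
move=> c0; pose e x := expR (- (c * `|x - n|)).
pose f (p : R * R) : R := e p.1 *
  cos (th + 2 * pi * xi * p.1 + 2 * pi * (p.1 - n) * p.2) * \1_`[- 2^-1, 2^-1] p.2.
have me : measurable_fun setT e.
  by apply: continuous_measurable_fun; exact: continuous_exp_dist.
have e0 x : 0 <= e x by exact: expR_ge0.
have mcos : measurable_fun setT (@cos R).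
  by apply: continuous_measurable_fun; exact: continuous_cos.
have mind : measurable_fun setT (\1_`[- 2^-1, 2^-1] : R -> R).
  exact: measurable_indic.
have mf1 : measurable_fun setT (fun p : R * R => p.1) by exact: measurable_fst.
have mf2 : measurable_fun setT (fun p : R * R => p.2) by exact: measurable_snd.
have mf : measurable_fun setT (EFin \o f).
  apply/measurable_EFinP; apply: measurable_funM; first apply: measurable_funM.
  - exact: measurableT_comp.
  - apply: measurableT_comp => //; apply: measurable_funD.
      by apply: measurable_funD => //; apply: measurable_funM.
    apply: measurable_funM => //; apply: measurable_funM => //.
    exact: measurable_funB.
  - exact: measurableT_comp.
have fi : (mu \x mu)%E.-integrable setT (EFin \o f).
  apply/integrable12ltyP => //.
  have le_e x : (\int[mu]_y `|(EFin \o f) (x, y)| <= (e x)%:E)%E.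
    apply: (@le_trans _ _ (\int[mu]_y ((e x)%:E * (\1_`[- 2^-1, 2^-1] y)%:E))%E).
      apply: ge0_le_integral => //.
      - apply: measurableT_comp => //; apply: (measurableT_comp mf).
        exact: measurable_pair1.
      - by apply: emeasurable_funM => //; apply/measurable_EFinP.
      - move=> y _ /=; rewrite -EFinM lee_fin !normrM (ger0_norm (e0 _)).
        rewrite (@ger0_norm _ (\1__ y)) ?ler_wpM2r//.
        by rewrite ler_piMr// cos_max.
    rewrite ge0_integralZl//; [|exact/measurable_EFinP|by rewrite lee_fin].
    rewrite integral_indic// setIT; by rewrite [X in (_ * X)%E]lebesgue_measure_unit_itv mule1.
  apply: (@le_lt_trans _ _ (\int[mu]_x (e x)%:E)%E).
    apply: ge0_le_integral => //.
    - by move=> x _; apply: integral_ge0.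
    - apply: (@measurable_fun_fubini_tonelli_F _ _ _ _ _ mu (abse \o (EFin \o f))) => //.
        exact: measurableT_comp.
      by move=> p; exact: abse_ge0.
    - exact/measurable_EFinP.
  by rewrite /e integral_exp_dist// ltry.
have := Fubini fi.
transitivity (fine (\int[mu]_x (\int[mu]_y (EFin \o f) (x, y)))%E).
  congr fine; apply: eq_integral => x _.
  rewrite /f/= integral_indic_itv EFin_Rintegral//; last first.
    apply: integrable_continuous_itv => y; apply: cvgM; first exact: cvg_cst.
    exact: continuous_cos_affine.
  rewrite RintegralZl//; last first.
    by apply: integrable_continuous_itv; exact: continuous_cos_affine.
  rewrite integral_cos_sinc; by congr (_ * _)%:E; rewrite mulrC.
rewrite (Fubini fi).
transitivity (\int[mu]_(y in `[- 2^-1, 2^-1])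
   (cos (th + 2 * pi * xi * n) * (2 * c / (c ^+ 2 + (2 * pi * (xi + y)) ^+ 2)))).
  congr fine; rewrite -integral_indic_itv; apply: eq_integral => y _.
  transitivity (\int[mu]_x ((\1_`[- 2^-1, 2^-1] y)%:E *
      (e x * cos ((th - 2 * pi * n * y) + 2 * pi * (xi + y) * x))%:E))%E.
    apply: eq_integral => x _; rewrite -EFinM /f/=; congr EFin.
    by rewrite [RHS]mulrC; congr (_ * cos _ * _); ring.
  have ic := @integrable_exp_bounded R c n _ c0
    (continuous_measurable_fun
      (@continuous_cos_affine R (th - 2 * pi * n * y) (2 * pi * (xi + y)))) (fun x => cos_max _).
  rewrite integralZl// EFin_Rintegral// Rintegral_exp_cos// -EFinM mulrC.
  by congr (_ * _)%:E; rewrite mulrC; congr (cos _ * _); ring.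
rewrite RintegralZl//; first by rewrite integral_poisson.
by apply: integrable_continuous_itv; exact: continuous_poisson.
Qed.

End Mollifier.

Section Approximants.
Context {R : realType}.
Local Open Scope complex_scope.
Local Notation mu := (@lebesgue_measure R).
Implicit Types (x xi c t y : R) (a : int -> R[i]) (n : int) (A : {fset int}).

(** With [d = pi / 2 - atan y] one has [sin d ^+ 2 = 1 / (1 + y ^+ 2)] and
    [0 < d <= 2], and [sinc_defect] bounds [d ^+ 2 - sin d ^+ 2] by
    [4 * sin d ^+ 2]. *)
Lemma atan_tail y : 0 <= y -> (pi / 2 - atan y) ^+ 2 <= 5 / (1 + y ^+ 2).
Proof.
move=> y0; set d := pi / 2 - atan y.
have d0 : 0 < d by rewrite subr_gt0 atan_ltpi2.
have a0 : 0 <= atan y by rewrite -atan0; exact: le_atan.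
have p0 := @pi_gt0 R; have p2 := @pihalf_lt2 R.
have d2 : d <= 2 by rewrite /d; lra.
have sd : sin d ^+ 2 = (1 + y ^+ 2)^-1.
  rewrite /d sinB sin_pihalf cos_pihalf mul1r mul0r subr0 cos_atan exprVn.
  by rewrite sqr_sqrtr// ltW// lorentz_den_gt0.
have dpi : pi * (d / pi) = d by rewrite mulrC divfK// gt_eqF.
have /sinc_defect : `|d / pi| <= 2^-1.
  rewrite ger0_norm; last by rewrite divr_ge0// ltW.
  by rewrite ler_pdivrMr// mulrC /d; lra.
have := mul_sinc (d / pi); rewrite dpi => hs hd.
have e1 : d ^+ 2 * (1 - sinc (d / pi) ^+ 2) <= d ^+ 2 * sin d ^+ 2.
  by rewrite ler_wpM2l ?sqr_ge0.
have e2 : d ^+ 2 * sinc (d / pi) ^+ 2 = sin d ^+ 2 by rewrite -exprMn hs.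
have e3 : d ^+ 2 * sin d ^+ 2 <= 4 * sin d ^+ 2.
  rewrite ler_wpM2r ?sqr_ge0//; have := mulr_ge0 (ltW d0) (ltW d0).
  by rewrite expr2; nra.
by rewrite -sd; lra.
Qed.

(** At [y = 0] both values of [s] are admitted, because [box] is the indicator of a
    closed interval. *)
Lemma atan_sgn_error y (s : R) : (0 <= y /\ s = 2^-1) \/ (y <= 0 /\ s = - 2^-1) ->
  (atan y / pi - s) ^+ 2 <= 2 / (1 + y ^+ 2).
Proof.
have p2 := @pi_ge2 R.
have main (z : R) : 0 <= z -> (atan z / pi - 2^-1) ^+ 2 <= 2 / (1 + z ^+ 2).
  move=> z0; have h := atan_tail z0.
  have -> : (atan z / pi - 2^-1) ^+ 2 = (pi / 2 - atan z) ^+ 2 / pi ^+ 2.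
    by have : pi != 0 :> R by [rewrite gt_eqF// pi_gt0]; move: (@pi R) => q q0; field.
  rewrite ler_pdivrMr ?exprn_gt0 ?pi_gt0//; apply: le_trans h _.
  rewrite mulrAC ler_wpM2r ?invr_ge0 ?(ltW (lorentz_den_gt0 _))//.
  have : 2 * 2 <= pi * pi :> R by rewrite ler_pM.
  by rewrite expr2; lra.
move=> [[y0 ->]|[y0 ->]]; first exact: main.
have := @main (- y); rewrite oppr_ge0 sqrrN atanN => /(_ y0).
by rewrite mulNr -opprD sqrrN opprK.
Qed.

Definition box xi : R := \1_`[- 2^-1, 2^-1] xi.

Lemma boxE xi : box xi = if - 2^-1 <= xi <= 2^-1 then 1 else 0.
Proof. by rewrite /box indicE mem_setE in_itv/=; case: ifP. Qed.

Lemma smooth_box_error c xi : 0 < c ->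
  (smooth_box c xi - box xi) ^+ 2 <=
  4 * lorentz (2 * pi / c) (- 2^-1) xi + 4 * lorentz (2 * pi / c) 2^-1 xi.
Proof.
move=> c0; have K0 : 0 < 2 * pi / c by rewrite divr_gt0// mulr_gt0// pi_gt0.
pose s1 : R := if - 2^-1 <= xi then 2^-1 else - 2^-1.
pose s2 : R := if xi <= 2^-1 then - 2^-1 else 2^-1.
have -> : box xi = s1 - s2.
  by rewrite boxE /s1 /s2; have [h1|h1] := leP (- 2^-1) xi;
    have [h2|h2] := leP xi 2^-1 => //=; lra.
rewrite /lorentz opprK /smooth_box; set K := 2 * pi / c in K0 *.
have e1 : (atan (K * (xi + 2^-1)) / pi - s1) ^+ 2 <= 2 / (1 + (K * (xi + 2^-1)) ^+ 2).
  apply: atan_sgn_error; rewrite /s1; have [h|h] := leP (- 2^-1) xi; [left|right].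
    by split => //; apply: mulr_ge0; [exact: ltW|lra].
  by split => //; apply: mulr_ge0_le0; [exact: ltW|lra].
have e2 : (atan (K * (xi - 2^-1)) / pi - s2) ^+ 2 <= 2 / (1 + (K * (xi - 2^-1)) ^+ 2).
  apply: atan_sgn_error; rewrite /s2; have [h|h] := leP xi 2^-1; [right|left].
    by split => //; apply: mulr_ge0_le0; [exact: ltW|lra].
  by split => //; apply: mulr_ge0; [exact: ltW|lra].
move: e1 e2; rewrite mulrBl.
set u := atan (K * (xi + 2^-1)) / pi; set v := atan (K * (xi - 2^-1)) / pi.
set p := (1 + (K * (xi + 2^-1)) ^+ 2)^-1; set q := (1 + (K * (xi - 2^-1)) ^+ 2)^-1.
move: (u) (v) (p) (q) => {}u {}v {}p {}q e1 e2.
by have := sqr_ge0 ((u - s1) + (v - s2)); lra.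
Qed.

(** The factor [1 - expR (- (c * |u|))] is at most [1] and at most [c * |u|], and both
    [sinc u] and [u * sinc u] are bounded. *)
Lemma sinc_damping_error c x n : 0 < c ->
  (sinc (x - n%:~R) - expR (- (c * `|x - n%:~R|)) * sinc (x - n%:~R)) ^+ 2 <=
  2 * c ^+ 2 * lorentz c n%:~R x.
Proof.
move=> c0; rewrite /lorentz; move: (x - _) => u.
rewrite ler_pdivlMr ?lorentz_den_gt0//.
have -> : sinc u - expR (- (c * `|u|)) * sinc u = (1 - expR (- (c * `|u|))) * sinc u by ring.
set w := 1 - _.
have w0 : 0 <= w by rewrite subr_ge0 -expR0 ler_expR oppr_le0 mulr_ge0// ltW.
have w1 : w <= 1 by rewrite gerBl expR_ge0.
have wc : w <= c * `|u|.
  by have := expR_ge1Dx (- (c * `|u|)); rewrite /w; lra.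
have s1 := sinc_le1 u; have s2 := mul_sinc_le1 u; rewrite normrM in s2.
rewrite -(real_normK (num_real (w * sinc u))) -[(c * u) ^+ 2]real_normK ?num_real//.
rewrite !normrM (gtr0_norm c0) (ger0_norm w0).
have s0 : 0 <= `|sinc u| := normr_ge0 _; have u0 : 0 <= `|u| := normr_ge0 _.
move: `|u| `|sinc u| u0 s0 s1 s2 wc => v s v0 s0 s1 s2 wc.
have f1 : (w * s) ^+ 2 <= c ^+ 2.
  rewrite ler_sqr ?nnegrE ?mulr_ge0 ?(ltW c0)//.
  apply: (@le_trans _ _ (c * (v * s))); first by rewrite mulrA ler_wpM2r.
  by rewrite ler_piMr// ltW.
have f2 : (w * s * (c * v)) ^+ 2 <= c ^+ 2.
  rewrite ler_sqr ?nnegrE ?mulr_ge0 ?(ltW c0)//.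
  have -> : w * s * (c * v) = w * (c * (v * s)) by ring.
  apply: (@le_trans _ _ (1 * (c * 1))); last by rewrite mul1r mulr1.
  by rewrite ler_pM ?mulr_ge0 ?ler_wpM2l ?(ltW c0).
by rewrite mulrDr mulr1 -exprMn; lra.
Qed.

(** A crude constant suffices where [s] is fixed and the damping tends to 0. *)
Lemma sqr_normc_sum_le (I : Type) (s : seq I) (u : I -> R[i]) :
  normc (\sum_(i <- s) u i) ^+ 2 <= 2 ^+ size s * \sum_(i <- s) normc (u i) ^+ 2.
Proof.
elim: s => [|i s IH].
  by rewrite !big_nil ComplexField.Normc.normc0 expr0n/= mulr0.
rewrite !big_cons/=; apply: le_trans (sqr_normcD_le _ _) _.
rewrite mulrDr lerD//.
  rewrite ler_wpM2r ?sqr_ge0// [2 ^+ (size s).+1]exprS ler_peMr// exprn_ege1//; lra.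
by rewrite [2 ^+ (size s).+1]exprS -mulrA ler_wpM2l.
Qed.

Definition card_sum a A x : R[i] := \sum_(n <- A) cardinal_term a x n.

(** The summand [+ 0] is the shift of frequencies in [gram_integers]. *)
Definition freqs a A : seq (R[i] * R) := [seq (a n, (- n)%:~R + 0) | n <- A].

(** The Fourier transform of [card_sum a A], as a function in L^2. *)
Definition card_hat a A xi : R[i] := (box xi)%:C * trig_poly (freqs a A) xi.

(** Each term is damped about its own center, which leaves its Fourier transform a
    function independent of [n], namely [smooth_box c], times an exponential. *)
Definition damped a A c x : R[i] :=
  \sum_(n <- A) a n * (expR (- (c * `|x - n%:~R|)) * sinc (x - n%:~R))%:C.

Lemma cis_norm (t : R) : normc (cis t) ^+ 2 = 1.
Proof. by rewrite sqr_normc_Re_Im /= cos2Dsin2. Qed.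

Lemma card_sum_error a A c x : 0 < c ->
  normc (card_sum a A x - damped a A c x) ^+ 2 <=
  \sum_(n <- A) 2 ^+ size A * normc (a n) ^+ 2 * (2 * c ^+ 2) * lorentz c n%:~R x.
Proof.
move=> c0; rewrite /card_sum /damped -sumrB.
apply: le_trans (sqr_normc_sum_le _ _) _; rewrite mulr_sumr; apply: ler_sum => n _.
rewrite /cardinal_term -mulrBr -rmorphB ComplexField.Normc.normcM exprMn normc_real_sqr.
by rewrite mulrA -[leRHS]mulrA ler_wpM2l ?sinc_damping_error// mulr_ge0 ?sqr_ge0 ?exprn_ge0.
Qed.

End Approximants.

(** * L^2 bounds for the partial sums *)

Section PartialSums.
Context {R : realType}.
Local Open Scope complex_scope.
Local Notation mu := (@lebesgue_measure R).
Implicit Types (x xi c t s : R) (a : int -> R[i]) (n : int) (A : {fset int}).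

Lemma sinc_ge0 x : `|x| <= 2^-1 -> 0 <= sinc x.
Proof.
wlog x0 : x / 0 <= x.
  by move=> h; have [/h//|/ltW] := lerP 0 x; rewrite -oppr_ge0 => /h; rewrite normrN sincN.
rewrite ger0_norm// => x2; move: x0; rewrite le_eqVlt => /predU1P[<-|x0].
  by rewrite sinc0.
have [k /andP[k0 kx] ->] := sinc_eq_cos x0; have p0 := @pi_gt0 R.
by apply: cos_ge0_pihalf; apply/andP; split; nra.
Qed.

Lemma continuous_sinc : continuous (@sinc R).
Proof.
move=> x; have [->|x0] := eqVneq x 0; last first.
  have e : {near x, (fun y => sin (pi * y) / (pi * y)) =1 @sinc R}.
    near=> y; rewrite /sinc ifF//; apply/negbTE; near: y.
    exact: (@cvgr_neq0 _ _ _ (nbhs x) _ id x cvg_id x0).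
  apply: cvg_trans (near_eq_cvg e) _.
  have -> : sinc x = sin (pi * x) / (pi * x) by rewrite /sinc (negbTE x0).
  apply: cvgM.
    apply: (@continuous_comp _ _ _ (fun y => pi * y) sin); last exact: continuous_sin.
    by apply: cvgM => //; exact: cvg_cst.
  apply: cvgV; first by rewrite mulf_neq0// gt_eqF// pi_gt0.
  by apply: cvgM => //; exact: cvg_cst.
rewrite /continuous_at sinc0; apply/cvgrPdist_lt => e e0.
have h1 : 0 < 2^-1 :> R by rewrite invr_gt0.
have h2 : 0 < e / pi by rewrite divr_gt0// pi_gt0.
near=> y.
have y2 : `|y| < 2^-1 by near: y; exact: (@nbhs0_lt R R _ h1).
have ye : `|y| < e / pi by near: y; exact: (@nbhs0_lt R R _ h2).
have d := sinc_defect (ltW y2).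
have s0 := sinc_ge0 (ltW y2).
have s1 := sinc_le1 y; rewrite ger0_norm// in s1.
rewrite ger0_norm ?subr_ge0//.
apply: (@le_lt_trans _ _ (1 - sinc y ^+ 2)).
  by rewrite lerD2l lerN2 expr2 ler_piMr.
apply: le_lt_trans d _; rewrite -[sin _ ^+ 2]real_normK ?num_real//.
apply: (@le_lt_trans _ _ `|sin (pi * y)|).
  by rewrite expr2 ler_piMl// sin_max.
rewrite -mul_sinc !normrM (gtr0_norm (@pi_gt0 R)).
apply: (@le_lt_trans _ _ (pi * `|y|)).
  by rewrite ler_piMr ?sinc_le1// mulr_ge0// pi_ge0.
by rewrite mulrC -ltr_pdivlMr// pi_gt0.
Unshelve. all: by end_near. Qed.

Definition cmeas (f : R -> R[i]) : Prop :=
  measurable_fun setT (fun x => complex.Re (f x)) /\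
  measurable_fun setT (fun x => complex.Im (f x)).

Definition ccont (f : R -> R[i]) : Prop :=
  continuous (fun x => complex.Re (f x)) /\ continuous (fun x => complex.Im (f x)).

Lemma ccont_cmeas f : ccont f -> cmeas f.
Proof. by move=> [h k]; split; exact: continuous_measurable_fun. Qed.

Lemma continuous_sqr_normc f : ccont f -> continuous (fun x => normc (f x) ^+ 2).
Proof.
move=> [h k] x; under eq_fun do rewrite sqr_normc_Re_Im.
by apply: cvgD; [apply: cvgM; exact: h|apply: cvgM; exact: k].
Qed.

Lemma measurable_sqr_normc f : cmeas f ->
  measurable_fun setT (fun x => normc (f x) ^+ 2).
Proof.
move=> [h k]; under eq_fun do rewrite sqr_normc_Re_Im.
by apply: measurable_funD; exact: measurable_funX.
Qed.

Lemma ccont_card_sum a A : ccont (card_sum a A).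
Proof.
have sh n : continuous (fun x => sinc (x - n%:~R)).
  move=> x; apply: (@continuous_comp _ _ _ (fun x => x - n%:~R) (@sinc R)).
    by apply: cvgB => //; exact: cvg_cst.
  exact: continuous_sinc.
split.
  under eq_fun => x do rewrite /card_sum Re_sum.
  apply: continuous_sum => n x.
  rewrite /continuous_at /cardinal_term; case: (a n) => p q /=.
  under eq_fun do rewrite mulr0 subr0; rewrite mulr0 subr0.
  by apply: cvgM; [exact: cvg_cst|exact: sh].
under eq_fun => x do rewrite /card_sum Im_sum.
apply: continuous_sum => n x.
rewrite /continuous_at /cardinal_term; case: (a n) => p q /=.
under eq_fun do rewrite mulr0 add0r; rewrite mulr0 add0r.
by apply: cvgM; [exact: cvg_cst|exact: sh].
Qed.

Lemma card_sum_bessel a A s : sum_le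
  (fun m : int => normc (card_sum a A (m%:~R + s)) ^+ 2)
  (\sum_(n <- A) normc (a n) ^+ 2).
Proof.
have := bessel [seq (a n, n%:~R + 0) | n <- A] s.
rewrite (gram_integers _ _ _ (@inj_id int)); apply: sum_le_mono => m.
rewrite big_map/= /card_sum le_eqVlt; apply/orP; left; apply/eqP.
congr (normc _ ^+ 2); apply: eq_bigr => n _.
by rewrite /cardinal_term addr0 -[in RHS]opprB sincN.
Qed.

Lemma sum_le_ord (f : nat -> R) M k : sum_le f M -> \sum_(i < k) f i <= M.
Proof.
move=> h; have := h [fset i in iota 0 k]%fset.
rewrite -(big_mkord xpredT) /index_iota subn0; apply: le_trans.
rewrite le_eqVlt; apply/orP; left; apply/eqP.
apply/perm_big/uniq_perm; rewrite ?iota_uniq ?fset_uniq// => i.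
by rewrite !inE.
Qed.

Lemma integral_shift (G : R -> R) (d : R) : continuous G ->
  (\int[mu]_(x in `[d, (d + 1)%R]) (G x)%:E =
   \int[mu]_(x in `[0%R, 1%R]) (G (d + x)%R)%:E)%E.
Proof.
move=> cG; have dF (x : R) : is_derive x 1 (fun x => d + x) 1.
  by apply: is_derive_eq; rewrite add0r mulr1.
have F' : derive1 (fun x : R => d + x) = cst 1.
  by apply/funext => x; rewrite derive1E; exact: derive_val.
have cF (x : R) : {for x, continuous (fun x => d + x)}.
  by apply: cvgD => //; exact: cvg_cst.
have := @integration_by_substitution_increasing R (fun x => d + x) G 0 1 ler01.
rewrite addr0 F' => -> //.
- by apply: eq_integral => x _; rewrite /= !fctE mulr1.
- by move=> x y _ _ xy; rewrite ltrD2l.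
- by move=> x _; exact: cvg_cst.
- exact: is_cvg_cst.
- exact: is_cvg_cst.
- split => [x _||].
  + by case: (dF x).
  + by apply: cvg_at_right_filter; exact: cF.
  + by apply: cvg_at_left_filter; exact: cF.
- exact: continuous_subspaceT.
Qed.

Lemma integral_unit_cells (G : R -> R) (d : R) k : continuous G ->
  (forall x, 0 <= G x) ->
  (\int[mu]_(x in `[d, (d + k%:R)%R]) (G x)%:E =
   \sum_(i < k) \int[mu]_(x in `[0%R, 1%R]) (G (d + i%:R + x)%R)%:E)%E.
Proof.
move=> cG G0; elim: k => [|k IH].
  by rewrite addr0 set_itv1 integral_set1 big_ord0.
have mG (D : set R) : measurable_fun D (fun x => (G x)%:E).
  by apply/measurable_EFinP; apply: measurable_funTS; exact: continuous_measurable_fun.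
have k0 : d <= d + k%:R by rewrite lerDl.
have k1 : d + k%:R <= d + k%:R + 1 by rewrite lerDl.
rewrite -natr1 addrA big_ord_recr/= -IH -integral_shift//.
rewrite -[X in (_ + X)%E]integral_itv_obnd_cbnd// -ge0_integral_setU//=.
- congr (integral _ _ _); apply/seteqP; split => x /=; rewrite !in_itv/=.
    move=> /andP[h1 h2]; have [h|h] := leP x (d + k%:R); [left|right]; exact/andP.
  by move=> [/andP[h1 h2]|/andP[h1 h2]]; apply/andP; split=> //; lra.
- exact: mG.
- by move=> x _; rewrite lee_fin.
- apply/disj_setPS => x [] /=; rewrite !in_itv/= => /andP[_ h1] /andP[h2 _].
  by have := lt_le_trans h2 h1; rewrite ltxx.
Qed.

(** Cutting the line into unit cells, Bessel's inequality applies at each point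
    of the cell to the samples of the partial sum on its translates. *)
Lemma integral_card_sum_le a A :
  (\int[mu]_x (normc (card_sum a A x) ^+ 2)%:E <=
   (\sum_(n <- A) normc (a n) ^+ 2)%:E)%E.
Proof.
pose G x := normc (card_sum a A x) ^+ 2.
have cG : continuous G by apply: continuous_sqr_normc; exact: ccont_card_sum.
have G0 x : 0 <= G x by rewrite sqr_ge0.
have mG (D : set R) : measurable_fun D (fun x => (G x)%:E).
  by apply/measurable_EFinP; apply: measurable_funTS; exact: continuous_measurable_fun.
pose M := \sum_(n <- A) normc (a n) ^+ 2.
have cell (N : nat) : (\int[mu]_(x in `[(- N%:R)%R, N%:R]) (G x)%:E <= M%:E)%E.
  have e : N%:R = - N%:R + (N + N)%:R :> R by rewrite natrD; ring.
  rewrite {2}e.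
  rewrite integral_unit_cells//.
  have cGs (i : nat) : continuous (fun x => G (- N%:R + i%:R + x)).
    move=> x; apply: (@continuous_comp _ _ _ (fun x => - N%:R + i%:R + x) G).
      by apply: cvgD => //; exact: cvg_cst.
    exact: cG.
  rewrite (eq_bigr (fun i : 'I_(N + N) =>
    (\int[mu]_(x in `[0, 1]) G (- N%:R + i%:R + x))%:E)) => [|i _]; last first.
    by rewrite EFin_Rintegral//; apply: integrable_continuous_itv; exact: cGs.
  rewrite sumEFin lee_fin -Rintegral_itv_sum; last by move=> i; exact: cGs.
  have -> : M = \int[mu]_(x in `[0, 1]) M.
    have dF x : is_derive x 1 (fun x => M * x) M.
      by apply: is_derive_eq; rewrite /GRing.scale/= mulr1 ?mulr0 ?add0r ?addr0.
    rewrite (FTC_derive ltr01 _ dF); first by rewrite mulr0 subr0 mulr1.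
    by move=> x; exact: cvg_cst.
  apply: le_Rintegral => //.
  - by apply: integrable_continuous_itv; apply: continuous_sum => i; exact: cGs.
  - by apply: integrable_continuous_itv => x; exact: cvg_cst.
  move=> x _; have inj : injective (fun i : nat => (i%:Z - N%:Z)%R) by move=> i j; lia.
  have := sum_le_ord (N + N) (sum_le_inj inj (card_sum_bessel a A x)).
  move=> h; apply: le_trans h; rewrite le_eqVlt; apply/orP; left; apply/eqP.
  apply: eq_bigr => i _; rewrite /G; congr (normc (card_sum _ _ _) ^+ 2).
  by rewrite intrB; ring.
pose F (N : nat) : set R := `[(- N%:R)%R, N%:R]%classic.
have FT : \bigcup_N F N = setT.
  apply/seteqP; split => // x _; exists (Num.bound `|x|) => //.
  have := archi_boundP (normr_ge0 x); rewrite /F/= in_itv/= ltr_norml => /andP[h1 h2].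
  by rewrite !ltW.
have hlim0 := @ge0_nondecreasing_set_cvg_integral _ (measurableTypeR R) R F (fun x => (G x)%:E) mu.
have hlim : (\int[mu]_(x in F i) (G x)%:E)%E @[i --> \oo] --> (\int[mu]_x (G x)%:E)%E.
  rewrite -FT; apply: hlim0 => [m p mp|i|i|i x _].
  - apply/subsetPset => x; rewrite /F/= !in_itv/= => /andP[h1 h2].
    have mpR : m%:R <= p%:R :> R by rewrite ler_nat.
    by apply/andP; split; lra.
  - exact: measurable_itv.
  - exact: mG.
  - by rewrite lee_fin.
rewrite -(cvg_lim _ hlim)//; apply: lime_le; first by apply/cvg_ex; eexists; exact: hlim.
by apply: nearW => N; exact: cell.
Qed.

End PartialSums.

Section Energy.
Context {R : realType}.
Local Open Scope complex_scope.
Local Notation mu := (@lebesgue_measure R).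
Implicit Types (x xi c t s : R) (a : int -> R[i]) (n : int) (A : {fset int})
  (f g h : R -> R[i]).

(** The square of the L^2 norm, which spares the exponents [1/2]. *)
Definition energy f : \bar R := (\int[mu]_x (normc (f x) ^+ 2)%:E)%E.

Lemma poweR_Lnorm2 (u : R -> R) :
  ('N[mu]_2%:E[EFin \o u] `^ 2 = \int[mu]_x (u x ^+ 2)%:E)%E.
Proof.
rewrite powR_Lnorm//; apply: eq_integral => x _ /=.
by rewrite powR_mulrn// real_normK ?num_real.
Qed.

Lemma cdist2_lt f g (e : R) : 0 < e ->
  (energy (fun x => f x - g x)%R < (e ^+ 2)%:E)%E -> (cdist2 f g < e%:E)%E.
Proof.
move=> e0; rewrite !ltNge; apply: contra => h.
rewrite /energy -(poweR_Lnorm2 (fun x => normc (f x - g x))).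
have -> : ((e ^+ 2)%:E = e%:E `^ 2)%E by rewrite poweR_EFin powR_mulrn// ltW.
by apply: gt0_ler_poweR => //; rewrite in_itv/= leey andbT ?Lnorm_ge0// lee_fin ltW.
Qed.

Lemma Lfun2_intro (u : R -> R) : measurable_fun setT u ->
  (\int[mu]_x (u x ^+ 2)%:E < +oo)%E -> u \in Lfun mu 2%:E.
Proof.
move=> mu_ fu; rewrite inE; apply/andP; split; rewrite inE//=.
rewrite /finite_norm; apply: (@lty_poweRy _ _ 2) => //.
by rewrite poweR_Lnorm2.
Qed.

Lemma energy_cLp2 f : cmeas f -> (energy f < +oo)%E -> cLp 2%:E f.
Proof.
move=> mf fin; have ms := measurable_sqr_normc mf; case: (mf) => mr mi.
split; apply: Lfun2_intro => //; apply: le_lt_trans fin; apply: ge0_le_integral => //.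
- by move=> x _; rewrite lee_fin sqr_ge0.
- by apply/measurable_EFinP; exact: measurable_funX.
- exact/measurable_EFinP.
- by move=> x _; rewrite lee_fin sqr_normc_Re_Im lerDl sqr_ge0.
- by move=> x _; rewrite lee_fin sqr_ge0.
- by apply/measurable_EFinP; exact: measurable_funX.
- exact/measurable_EFinP.
- by move=> x _; rewrite lee_fin sqr_normc_Re_Im lerDr sqr_ge0.
Qed.

Lemma cmeasB f g : cmeas f -> cmeas g -> cmeas (fun x => f x - g x).
Proof.
move=> [f1 f2] [g1 g2]; split.
  by under eq_fun do rewrite (raddfB (@complex.Re R)); exact: measurable_funB.
by under eq_fun do rewrite (raddfB (@complex.Im R)); exact: measurable_funB.
Qed.

Lemma cmeas_scale (r : R -> R) f : measurable_fun setT r -> cmeas f ->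
  cmeas (fun x => (r x)%:C * f x).
Proof.
move=> mr [f1 f2]; split.
  rewrite (_ : (fun x => _) = (fun x => r x * complex.Re (f x))).
    exact: measurable_funM.
  by apply/funext => x; case: (f x) => p q /=; rewrite mul0r subr0.
rewrite (_ : (fun x => _) = (fun x => r x * complex.Im (f x))).
  exact: measurable_funM.
by apply/funext => x; case: (f x) => p q /=; rewrite mul0r addr0.
Qed.

Lemma energy_triangle f g h : cmeas f -> cmeas g -> cmeas h ->
  (energy (fun x => f x - h x)%R <=
   2%:E * energy (fun x => f x - g x)%R + 2%:E * energy (fun x => g x - h x)%R)%E.
Proof.
move=> mf mg mh.
have m1 := measurable_sqr_normc (cmeasB mf mg).
have m2 := measurable_sqr_normc (cmeasB mg mh).
have m3 := measurable_sqr_normc (cmeasB mf mh).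
have sq (u : R -> R[i]) x : (0 <= (normc (u x) ^+ 2)%:E)%E by rewrite lee_fin sqr_ge0.
have Z u : cmeas u -> (2%:E * energy u = \int[mu]_x (2%:E * (normc (u x) ^+ 2)%:E))%E.
  move=> mu_; rewrite ge0_integralZl//.
  by apply/measurable_EFinP; exact: measurable_sqr_normc.
rewrite (Z _ (cmeasB mf mg)) (Z _ (cmeasB mg mh)).
rewrite -ge0_integralD//; last 4 first.
- by move=> x _; apply: mule_ge0 => //; exact: (sq (fun x => f x - g x)).
- by apply: emeasurable_funM => //; apply/measurable_EFinP.
- by move=> x _; apply: mule_ge0 => //; exact: (sq (fun x => g x - h x)).
- by apply: emeasurable_funM => //; apply/measurable_EFinP.
apply: ge0_le_integral => //.
- by move=> x _; exact: (sq (fun x => f x - h x)).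
- exact/measurable_EFinP.
- by apply: emeasurable_funD; apply: emeasurable_funM => //; apply/measurable_EFinP.
- move=> x _; rewrite -!EFinM -EFinD lee_fin.
  have := sqr_normcD_le (f x - g x) (g x - h x).
  by rewrite (_ : f x - g x + (g x - h x) = f x - h x)//; ring.
Qed.

Lemma energy_lorentz_le f (I : Type) (s : seq I) (k d m : I -> R) : cmeas f ->
  (forall i, 0 <= k i) -> (forall i, 0 < d i) ->
  (forall x, normc (f x) ^+ 2 <= \sum_(i <- s) k i * lorentz (d i) (m i) x) ->
  (energy f <= (\sum_(i <- s) k i * (pi / d i))%:E)%E.
Proof.
move=> mf k0 d0 le_f.
have cl i : continuous (fun x => k i * lorentz (d i) (m i) x).
  by move=> x; apply: cvgM; [exact: cvg_cst|exact: continuous_lorentz].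
apply: (@le_trans _ _ (\int[mu]_x (\sum_(i <- s) (k i * lorentz (d i) (m i) x)%:E))%E).
  apply: ge0_le_integral => //.
  - by move=> x _; rewrite lee_fin sqr_ge0.
  - by apply/measurable_EFinP; exact: measurable_sqr_normc.
  - apply: emeasurable_sum => i; apply/measurable_EFinP.
    exact: continuous_measurable_fun.
  - by move=> x _; rewrite sumEFin lee_fin.
rewrite ge0_integral_sum//; last 2 first.
- by move=> i; apply/measurable_EFinP; exact: continuous_measurable_fun.
- by move=> i x _; rewrite lee_fin mulr_ge0// lorentz_ge0.
rewrite -sumEFin le_eqVlt; apply/orP; left; apply/eqP; apply: eq_bigr => i _.
under eq_integral do rewrite EFinM.
rewrite ge0_integralZl//; last 3 first.
- by apply/measurable_EFinP; apply: continuous_measurable_fun; exact: continuous_lorentz.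
- by move=> x _; rewrite lee_fin lorentz_ge0.
- by rewrite lee_fin.
by rewrite integral_lorentz.
Qed.

Lemma ccont_trig_poly (v : seq (R[i] * R)) : ccont (trig_poly v).
Proof.
have cc (b : R) : continuous (fun t => cos (2 * pi * b * t)).
  rewrite (_ : (fun t => _) = (fun t => cos (0 + 2 * pi * b * t))).
    exact: continuous_cos_affine.
  by apply/funext => t; rewrite add0r.
have cs (b : R) : continuous (fun t => sin (2 * pi * b * t)).
  rewrite (_ : (fun t => _) = (fun t => sin (0 + 2 * pi * b * t))).
    exact: continuous_sin_affine.
  by apply/funext => t; rewrite add0r.
split.
  under eq_fun do rewrite /trig_poly Re_sum.
  apply: continuous_sum => -[[p q] b] t /=.
  by apply: cvgB; apply: cvgM; (try exact: cvg_cst); [exact: cc|exact: cs].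
under eq_fun do rewrite /trig_poly Im_sum.
apply: continuous_sum => -[[p q] b] t /=.
by apply: cvgD; apply: cvgM; (try exact: cvg_cst); [exact: cs|exact: cc].
Qed.

Lemma measurable_smooth_box c : measurable_fun setT (@smooth_box R c).
Proof.
apply: continuous_measurable_fun => x; apply: cvgM; last exact: cvg_cst.
have h b : {for x, continuous (fun xi => atan (2 * pi / c * (xi + b)))}.
  apply: (@continuous_comp _ _ _ (fun xi => 2 * pi / c * (xi + b)) (@atan R)).
    by apply: cvgM; [exact: cvg_cst|apply: cvgD => //; exact: cvg_cst].
  exact: continuous_atan.
by apply: cvgB; exact: h.
Qed.

Lemma cmeas_card_hat a A : cmeas (card_hat a A).
Proof.
apply: cmeas_scale; last by apply: ccont_cmeas; exact: ccont_trig_poly.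
exact: measurable_indic.
Qed.

Lemma normc_scale (r : R) (z : R[i]) : normc (r%:C * z) ^+ 2 = r ^+ 2 * normc z ^+ 2.
Proof. by rewrite ComplexField.Normc.normcM exprMn normc_real_sqr. Qed.

Lemma trig_poly_freqs a A xi :
  trig_poly (freqs a A) xi = \sum_(n <- A) a n * cis (- (2 * pi * n%:~R * xi)).
Proof.
rewrite /trig_poly big_map; apply: eq_bigr => n _ /=.
by congr (_ * cis _); rewrite mulrNz; ring.
Qed.

(** Orthonormality of the exponentials on [[-1/2, 1/2]]. *)
Lemma energy_card_hat a A : energy (card_hat a A) = (\sum_(n <- A) normc (a n) ^+ 2)%:E.
Proof.
have inj : injective (@GRing.opp int) by exact: oppr_inj.
rewrite -(gram_integers A a 0 inj) -integral_sqr_trig_poly -EFin_Rintegral//; last first.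
  by apply: integrable_continuous_itv; apply: continuous_sqr_normc; exact: ccont_trig_poly.
rewrite -integral_indic_itv; apply: eq_integral => x _; congr EFin.
rewrite /card_hat normc_scale mulrC; congr (_ * _).
by rewrite /box indicE; case: (_ \in _); rewrite ?expr1n ?expr0n.
Qed.

End Energy.

(** * Fourier transforms of the damped partial sums *)

Section FourierDamped.
Context {R : realType}.
Local Open Scope complex_scope.
Local Notation mu := (@lebesgue_measure R).
Implicit Types (x xi c t s : R) (a : int -> R[i]) (n : int) (A : {fset int})
  (f g h : R -> R[i]).

Lemma Rintegral_lincomb (I : Type) (s : seq I) (p q : I -> R) (C S : I -> R -> R) :
  (forall i, mu.-integrable setT (EFin \o C i)) ->
  (forall i, mu.-integrable setT (EFin \o S i)) ->
  \int[mu]_x (\sum_(i <- s) (p i * C i x + q i * S i x)) =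
  \sum_(i <- s) (p i * \int[mu]_x C i x + q i * \int[mu]_x S i x) /\
  mu.-integrable setT (fun x => (\sum_(i <- s) (p i * C i x + q i * S i x))%:E).
Proof.
move=> iC iS.
have it i : mu.-integrable setT (EFin \o (fun x => p i * C i x + q i * S i x)).
  have := integrableD measurableT (integrableZl measurableT (p i) (iC i))
                                 (integrableZl measurableT (q i) (iS i)).
  by apply: eq_integrable.
elim: s => [|i s [IHe IHi]].
  split; first by rewrite big_nil; under eq_Rintegral do rewrite big_nil;
    rewrite Rintegral_cst// mul0r.
  under eq_fun do rewrite big_nil; exact: integrable0.
split; last first.
  under eq_fun do rewrite big_cons.
  have := integrableD measurableT (it i) IHi.
  by apply: eq_integrable.
rewrite big_cons -IHe; under eq_Rintegral do rewrite big_cons.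
rewrite RintegralD//; congr (_ + _).
rewrite RintegralD//; last 2 first.
- by have := integrableZl measurableT (p i) (iC i); apply: eq_integrable.
- by have := integrableZl measurableT (q i) (iS i); apply: eq_integrable.
by rewrite !RintegralZl.
Qed.

(** For [th = 0] and [th = - (pi / 2)], the cosine and the sine part of a damped term
    times an exponential. *)
Definition wave c n xi th x : R :=
  expR (- (c * `|x - n%:~R|)) * (sinc (x - n%:~R) * cos (th + 2 * pi * xi * x)).

Lemma measurable_sinc_shift n : measurable_fun setT (fun x : R => sinc (x - n%:~R)).
Proof.
apply: continuous_measurable_fun => x.
apply: (@continuous_comp _ _ _ (fun x => x - n%:~R) (@sinc R)).
  by apply: cvgB => //; exact: cvg_cst.
exact: continuous_sinc.
Qed.

Lemma integrable_wave c n xi th : 0 < c ->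
  mu.-integrable setT (EFin \o wave c n xi th).
Proof.
move=> c0; apply: (@integrable_exp_bounded R c n%:~R
  (fun x => sinc (x - n%:~R) * cos (th + 2 * pi * xi * x)) c0).
  apply: measurable_funM; first exact: measurable_sinc_shift.
  by apply: continuous_measurable_fun; exact: continuous_cos_affine.
move=> x; rewrite normrM -[leRHS]mulr1.
by apply: ler_pM => //; [exact: sinc_le1|exact: cos_max].
Qed.

Lemma damped_wave a A c xi x :
  complex.Re (damped a A c x * cis (- (2 * pi * x * xi))) =
    \sum_(n <- A) (complex.Re (a n) * wave c n xi 0 x +
                   complex.Im (a n) * wave c n xi (- (pi / 2)) x) /\
  complex.Im (damped a A c x * cis (- (2 * pi * x * xi))) =
    \sum_(n <- A) (complex.Im (a n) * wave c n xi 0 x +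
                   - complex.Re (a n) * wave c n xi (- (pi / 2)) x).
Proof.
rewrite /damped mulr_suml Re_sum Im_sum; split; apply: eq_bigr => n _;
  rewrite /wave add0r [- (pi / 2) + _]addrC cosBpihalf /cis cosN sinN;
  rewrite (_ : 2 * pi * x * xi = 2 * pi * xi * x); [|ring| |ring];
  by case: (a n) => p q /=; ring.
Qed.

Lemma fourier_damped a A c xi : 0 < c ->
  fourier (damped a A c) xi = (smooth_box c xi)%:C * trig_poly (freqs a A) xi.
Proof.
move=> c0; rewrite /fourier /cintegral.
have iw n th := @integrable_wave c n xi th c0.
under eq_Rintegral => x _ do rewrite (damped_wave a A c xi x).1.
rewrite (Rintegral_lincomb A _ _ (fun n => iw n _) (fun n => iw n _)).1.
under eq_Rintegral => x _ do rewrite (damped_wave a A c xi x).2.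
rewrite (Rintegral_lincomb A _ _ (fun n => iw n _) (fun n => iw n _)).1.
under eq_bigr => n _ do rewrite /wave !integral_exp_sinc_cos//.
under [X in _ +i* X]eq_bigr => n _ do rewrite /wave !integral_exp_sinc_cos//.
rewrite trig_poly_freqs mulr_sumr; apply/eqP; rewrite eq_complex; apply/andP.
split; apply/eqP; rewrite ?Re_sum ?Im_sum /=; apply: eq_bigr => n _;
  rewrite add0r [- (pi / 2) + _]addrC cosBpihalf /cis cosN sinN;
  rewrite (_ : 2 * pi * n%:~R * xi = 2 * pi * xi * n%:~R); [|ring| |ring];
  by case: (a n) => p q /=; ring.
Qed.

Lemma damped_cLp1 a A c : 0 < c -> cLp 1%:E (damped a A c).
Proof.
move=> c0; have iw n th := @integrable_wave c n 0 th c0.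
have e x : damped a A c x = damped a A c x * cis (- (2 * pi * x * 0)).
  by rewrite mulr0 oppr0 /cis cos0 sin0 mulr1.
split; apply/Lfun1_integrable.
- have := (Rintegral_lincomb A (fun n => complex.Re (a n)) (fun n => complex.Im (a n))
    (fun n => iw n 0) (fun n => iw n (- (pi / 2)))).2.
  by apply: eq_integrable => // x _ /=; rewrite e (damped_wave a A c 0 x).1.
- have := (Rintegral_lincomb A (fun n => complex.Im (a n)) (fun n => - complex.Re (a n))
    (fun n => iw n 0) (fun n => iw n (- (pi / 2)))).2.
  by apply: eq_integrable => // x _ /=; rewrite e (damped_wave a A c 0 x).2.
Qed.

Lemma cLp_cmeas p f : cLp p f -> cmeas f.
Proof.
by move=> [/andP[h1 _] /andP[h2 _]]; split; [move: h1|move: h2]; rewrite inE.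
Qed.

Lemma cmeas_fourier_damped a A c : 0 < c -> cmeas (fourier (damped a A c)).
Proof.
move=> c0; rewrite (_ : fourier _ = (fun xi => (smooth_box c xi)%:C * trig_poly (freqs a A) xi)).
  apply: cmeas_scale; first exact: measurable_smooth_box.
  by apply: ccont_cmeas; exact: ccont_trig_poly.
by apply/funext => xi; exact: fourier_damped.
Qed.

(** The damped partial sum works as [h]: by [sinc_damping_error] and
    [smooth_box_error] both errors are of the order of the damping parameter [c]. *)
Lemma card_sum_approx a A (e : R) : 0 < e -> exists h,
  [/\ cLp 1%:E h, cmeas h, cmeas (fourier h),
      (energy (fun x => card_sum a A x - h x)%R < e%:E)%E &
      (energy (fun x => card_hat a A x - fourier h x)%R < e%:E)%E].
Proof.
move=> e0; have p0 := @pi_gt0 R.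
pose S : R := \sum_(n <- A) 2 ^+ size A * normc (a n) ^+ 2.
have S0 : 0 <= S by apply: sumr_ge0 => n _; rewrite mulr_ge0 ?exprn_ge0 ?normc_ge0.
pose c := e / (S * (2 * pi) + S * 4 + 1).
have D0 : 0 < S * (2 * pi) + S * 4 + 1.
  by rewrite ltr_wpDl// addr_ge0// mulr_ge0// mulr_ge0// ltW.
have c0 : 0 < c by rewrite divr_gt0.
have ce : c * (S * (2 * pi) + S * 4) < e.
  have -> : e = c * (S * (2 * pi) + S * 4 + 1) by rewrite divfK// gt_eqF.
  by rewrite ltr_pM2l// ltrDl.
have l1 := damped_cLp1 a A c0; have m1 := cLp_cmeas l1.
have m2 := cmeas_fourier_damped a A c0.
exists (damped a A c); split => //.
- apply: (@le_lt_trans _ _ (\sum_(n <- A)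
    (2 ^+ size A * normc (a n) ^+ 2 * (2 * c ^+ 2)) * (pi / c))%:E).
    apply: (@energy_lorentz_le R _ int A (fun n => 2 ^+ size A * normc (a n) ^+ 2 * (2 * c ^+ 2))
      (fun=> c) (fun n => n%:~R)) => //.
    + by apply: cmeasB => //; apply: ccont_cmeas; exact: ccont_card_sum.
    + by move=> n; apply: mulr_ge0; apply: mulr_ge0 => //; apply: exprn_ge0 => //;
        [exact: normc_ge0|exact: ltW].
    + by move=> x; exact: card_sum_error.
  rewrite lte_fin -mulr_suml -mulr_suml -/S.
  have -> : S * (2 * c ^+ 2) * (pi / c) = c * (S * (2 * pi)).
    by move: (@pi R) => q; field; rewrite gt_eqF.
  by apply: le_lt_trans ce; rewrite ler_wpM2l ?(ltW c0)// lerDl mulr_ge0.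
- have K0 : 0 < 2 * pi / c by rewrite divr_gt0// mulr_gt0.
  apply: (@le_lt_trans _ _ (\sum_(m <- [:: - 2^-1; 2^-1 : R])
    (S * 4) * (pi / (2 * pi / c)))%:E).
    apply: (@energy_lorentz_le R _ R _ (fun=> S * 4) (fun=> 2 * pi / c) id) => //.
    + by apply: cmeasB => //; exact: cmeas_card_hat.
    + by move=> _; rewrite mulr_ge0.
    move=> xi; rewrite fourier_damped// /card_hat -mulrBl -rmorphB normc_scale.
    rewrite !big_cons big_nil addr0.
    have hS : normc (trig_poly (freqs a A) xi) ^+ 2 <= S.
      rewrite trig_poly_freqs; apply: le_trans (sqr_normc_sum_le _ _) _.
      rewrite mulr_sumr; apply: ler_sum => n _.
      by rewrite ComplexField.Normc.normcM exprMn cis_norm mulr1.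
    have hb := smooth_box_error xi c0.
    have -> : (box xi - smooth_box c xi) ^+ 2 = (smooth_box c xi - box xi) ^+ 2 by ring.
    apply: le_trans (ler_pM (sqr_ge0 _) (sqr_ge0 _) hb hS) _.
    by rewrite le_eqVlt; apply/orP; left; apply/eqP; ring.
  rewrite lte_fin !big_cons big_nil addr0.
  have -> : S * 4 * (pi / (2 * pi / c)) + S * 4 * (pi / (2 * pi / c)) = c * (S * 4).
    by have : pi != 0 :> R by [rewrite gt_eqF]; move: (@pi R) => q q0; field; rewrite q0 gt_eqF.
  apply: le_lt_trans ce; rewrite ler_wpM2l ?(ltW c0)// lerDr mulr_ge0//.
  by rewrite mulr_ge0// ltW.
Qed.

End FourierDamped.

(** * The cardinal series lies in the Paley-Wiener space *)

Section PaleyWienerProof.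
Context {R : realType}.
Local Open Scope complex_scope.
Local Notation mu := (@lebesgue_measure R).
Implicit Types (x xi c t s : R) (a : int -> R[i]) (n : int) (A : {fset int})
  (f g h : R -> R[i]).

(** The finite sets beyond which the remainders are small are enlarged to an increasing
    sequence that contains [k] and [- k] from the index [k + 1] on. *)
Lemma exhausting_fsets (phi : int -> R) M (eps : nat -> R) :
  (forall n, 0 <= phi n) -> sum_le phi M -> (forall k, 0 < eps k) ->
  exists A : nat -> {fset int},
    [/\ forall k l, (k <= l)%N -> (A k `<=` A l)%fset,
        forall B : {fset int}, exists K, forall k, (K <= k)%N -> (B `<=` A k)%fset &
        forall k D, [disjoint D & A k]%fset -> \sum_(n <- D) phi n < eps k].
Proof.
move=> phi0 phiM eps0.
have [B hB] := choice (fun k => sum_le_tail phi0 phiM (eps0 k)).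
pose A := fix F k : {fset int} := if k is k'.+1 then
  (F k' `|` (B k `|` [fset k'%:Z; - k'%:Z]))%fset else B 0.
have mono k l : (k <= l)%N -> (A k `<=` A l)%fset.
  move=> /subnK <-; elim: (l - k)%N => [|d IH]; first by rewrite add0n fsubset_refl.
  by rewrite addSn; apply: fsubset_trans IH _; exact: fsubsetUl.
have BA k : (B k `<=` A k)%fset.
  case: k => [|k]; first exact: fsubset_refl.
  by apply/fsubsetP => n nB; rewrite !inE nB orbT.
exists A; split => //.
- move=> D; exists (\max_(n <- D) `|n|%N).+1 => k Dk; apply/fsubsetP => n nD.
  have nA : n \in A `|n|%N.+1.
    rewrite /= !inE; have [h|h] : n = `|n|%N%:Z \/ n = - `|n|%N%:Z by lia.
      by move/eqP: h => ->; rewrite !orbT.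
    by move/eqP: h => ->; rewrite !orbT.
  apply: (fsubsetP (mono _ _ _)) nA; apply: leq_trans Dk; rewrite ltnS.
  exact: (@leq_bigmax_seq _ (enum_fset D) xpredT absz n nD isT).
- move=> k D DA; apply: hB; apply/fdisjointP => n nD.
  by apply: contra (fdisjointP DA n nD); exact: (fsubsetP (BA k)).
Qed.

Lemma limn_einf_le (u : nat -> \bar R) (e : \bar R) :
  (forall k, (u k <= e)%E) -> (limn_einf u <= e)%E.
Proof.
move=> ue; rewrite limn_einf_lim; apply: lime_le; first exact: is_cvg_einfs.
apply: nearW => n; apply: le_trans (ue n).
by apply: ereal_inf_lbound; exists n => /=.
Qed.

Definition ccvg (u : nat -> R[i]) (w : R[i]) : Prop :=
  ((fun k => complex.Re (u k)) @ \oo --> complex.Re w) /\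
  ((fun k => complex.Im (u k)) @ \oo --> complex.Im w).

Lemma cmeas_lim (u : nat -> R -> R[i]) (w : R -> R[i]) :
  (forall k, cmeas (u k)) -> (forall x, ccvg (u^~ x) (w x)) -> cmeas w.
Proof.
move=> mu_ uw; split.
  apply: (measurable_fun_cvg (h := fun k x => complex.Re (u k x))) => [k|x _].
    exact: (mu_ k).1.
  exact: (uw x).1.
apply: (measurable_fun_cvg (h := fun k x => complex.Im (u k x))) => [k|x _].
  exact: (mu_ k).2.
exact: (uw x).2.
Qed.

(** Fatou's lemma, applied to the squares of the moduli. *)
Lemma energy_fatou (u : nat -> R -> R[i]) (w v : R -> R[i]) (e : \bar R) K :
  (forall k, cmeas (u k)) -> cmeas v -> (forall x, ccvg (u^~ x) (w x)) ->
  (forall k, (K <= k)%N -> (energy (fun x => u k x - v x)%R <= e)%E) ->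
  (energy (fun x => w x - v x)%R <= e)%E.
Proof.
move=> mu_ mv uw ue.
pose F k x := (normc (u (k + K)%N x - v x) ^+ 2)%:E.
have mF k : measurable_fun setT (F k).
  by apply/measurable_EFinP; apply: measurable_sqr_normc; exact: cmeasB.
have F0 k x : setT x -> (0 <= F k x)%E by rewrite lee_fin sqr_ge0.
have := @fatou _ _ R mu setT measurableT F mF F0.
have -> : (\int[mu]_x limn_einf (F^~ x) = energy (fun x => w x - v x)%R)%E.
  apply: eq_integral => x _.
  have [uR uI] := uw x.
  have h : (F^~ x) @ \oo --> (normc (w x - v x) ^+ 2)%:E.
    have lim (p q : nat -> R) (b d : R) : p @ \oo --> b -> q @ \oo --> d ->
        (fun k => p (k + K)%N ^+ 2 + q (k + K)%N ^+ 2) @ \oo --> b ^+ 2 + d ^+ 2.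
      move=> pb qd; have pK := cvg_comp _ _ (cvg_addnr K) pb.
      have qK := cvg_comp _ _ (cvg_addnr K) qd.
      by apply: cvgD; apply: cvgM.
    have := lim (fun k => complex.Re (u k x) - complex.Re (v x))
      (fun k => complex.Im (u k x) - complex.Im (v x)) _ _
      (cvgB uR (cvg_cst _)) (cvgB uI (cvg_cst _)).
    have sq (y z : R[i]) : (complex.Re y - complex.Re z) ^+ 2 +
        (complex.Im y - complex.Im z) ^+ 2 = normc (y - z) ^+ 2.
      by rewrite sqr_normc_Re_Im; case: y z => [? ?] [? ?].
    under eq_fun do rewrite sq; rewrite sq => h.
    by apply: cvg_EFin; [exact: nearW|exact: h].
  by rewrite (cvg_limn_einf_sup h).1.
move=> h; apply: le_trans h _; apply: limn_einf_le => k.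
by apply: ue; rewrite leq_addl.
Qed.

Lemma ccvg_sums a (A : nat -> {fset int}) x (s : R[i]) :
  (forall B : {fset int}, exists K, forall k, (K <= k)%N -> (B `<=` A k)%fset) ->
  sums (cardinal_term a x) s -> ccvg (fun k => card_sum a (A k) x) s.
Proof.
move=> exh hs.
have main (e : R) : 0 < e -> \forall k \near \oo, normc (card_sum a (A k) x - s) < e.
  move=> /hs[B hB]; have [K hK] := exh B.
  by exists K => // k /= Kk; apply: hB; exact: hK.
split; apply/cvgrPdist_lt => e /main; apply: filterS => k; apply: le_lt_trans.
  rewrite distrC -(raddfB (@complex.Re R)); exact: normr_Re_le.
by rewrite distrC -(raddfB (@complex.Im R)); exact: normr_Im_le.
Qed.

Lemma card_sum_diff a A B x : (A `<=` B)%fset ->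
  card_sum a B x - card_sum a A x = card_sum a (B `\` A)%fset x.
Proof. by move=> AB; rewrite /card_sum (big_fset_split _ AB) addrC addKr. Qed.

Lemma card_hat_diff a A B x : (A `<=` B)%fset ->
  card_hat a B x - card_hat a A x = card_hat a (B `\` A)%fset x.
Proof.
move=> AB; rewrite /card_hat -mulrBr !trig_poly_freqs (big_fset_split _ AB).
by rewrite addrC addKr.
Qed.

Lemma sum_geometric_le2 k : \sum_(i < k) 2^-1 ^+ i <= 2 :> R.
Proof.
suff -> : \sum_(i < k) 2^-1 ^+ i = 2 - 2 * 2^-1 ^+ k :> R.
  by rewrite gerBl mulr_ge0// exprn_ge0.
elim: k => [|k IH]; first by rewrite big_ord0 expr0 mulr1 subrr.
by rewrite big_ord_recr/= IH exprS; field.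
Qed.

(** The inequality [|D| <= 2 ^- k + 2 ^ k * |D| ^ 2] makes the sum of the moduli of
    the increments [D k] finite where the integrable sum of [2 ^ k * |D k| ^ 2]
    is. *)
Lemma ae_ccvg (G : nat -> R -> R[i]) : (forall k, cmeas (G k)) ->
  (forall k, (energy (fun x => G k.+1 x - G k x)%R <= ((4^-1) ^+ k)%:E)%E) ->
  exists E : set R, [/\ measurable E, {ae mu, forall x, E x} &
    forall x, E x -> exists w, ccvg (G^~ x) w].
Proof.
move=> mG hG; pose D k x := G k.+1 x - G k x.
have mD k : cmeas (D k) by exact: cmeasB.
pose F k x := (2 ^+ k * normc (D k x) ^+ 2)%:E.
have F0 k x : (0 <= F k x)%E by rewrite lee_fin mulr_ge0 ?exprn_ge0 ?normc_ge0.
have mF k : measurable_fun setT (F k).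
  apply/measurable_EFinP; apply: measurable_funM => //.
  exact: measurable_sqr_normc.
pose H x := (\sum_(0 <= k <oo) F k x)%E.
have mH : measurable_fun setT H by apply: ge0_emeasurable_sum.
have iH : (\int[mu]_x H x <= 2%:E)%E.
  rewrite integral_nneseries//; apply: lime_le.
    by apply: is_cvg_nneseries => k _ _; apply: integral_ge0.
  apply: nearW => n; rewrite big_mkord.
  apply: (@le_trans _ _ (\sum_(k < n) ((2^-1) ^+ k)%:E)%E); last first.
    by rewrite sumEFin lee_fin sum_geometric_le2.
  apply: lee_sum => k _; rewrite /F.
  under eq_integral do rewrite EFinM.
  rewrite ge0_integralZl//; last 2 first.
  - by apply/measurable_EFinP; exact: measurable_sqr_normc.
  - by move=> x _; rewrite lee_fin sqr_ge0.
  apply: (@le_trans _ _ ((2 ^+ k)%:E * ((4^-1) ^+ k)%:E)%E).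
    by apply: lee_wpmul2l; [rewrite lee_fin exprn_ge0|exact: hG].
  rewrite -EFinM lee_fin -exprMn le_eqVlt; apply/orP; left; apply/eqP.
  by congr (_ ^+ _); field.
have H0 x : (0 <= H x)%E by apply: nneseries_ge0.
exists [set x | (H x < +oo)%E]; split.
- by rewrite -[X in measurable X]setTI; exact: emeasurable_fun_infty_o.
- have iiH : mu.-integrable setT H.
    apply/integrableP; split => //.
    under eq_integral do rewrite gee0_abs//.
    by apply: le_lt_trans iH _; rewrite ltry.
  have := integrable_ae measurableT iiH; apply: filterS => x /(_ I).
  by rewrite ge0_fin_numE.
move=> x /= Hx.
have Hfin : H x \is a fin_num by rewrite ge0_fin_numE.
have bnd (n : nat) : \sum_(0 <= k < n) normc (D k x) <= 2 + fine (H x).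
  apply: (@le_trans _ _ (\sum_(0 <= k < n) ((2^-1) ^+ k + 2 ^+ k * normc (D k x) ^+ 2))).
    apply: ler_sum => k _; rewrite exprVn.
    have q0 : 0 < 2 ^+ k :> R by rewrite exprn_gt0.
    move: (2 ^+ k) (normc _) q0 (normc_ge0 (D k x)) => q z q0 z0.
    have qv : 0 < q^-1 by rewrite invr_gt0.
    have := mulr_ge0 (ltW qv) (sqr_ge0 (q * z - 1)).
    rewrite (_ : q^-1 * (q * z - 1) ^+ 2 = q * z ^+ 2 - 2 * z + q^-1); last first.
      by field; rewrite gt_eqF.
    have := mulr_ge0 (ltW q0) (sqr_ge0 z); lra.
  rewrite big_split/= lerD//; first by rewrite big_mkord; exact: sum_geometric_le2.
  rewrite -lee_fin fineK// -sumEFin.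
  by apply: (@nneseries_lim_ge _ (F^~ x) xpredT 0%N n) => k _ _; exact: F0.
have cv (p : R[i] -> R) : (forall y z, p (y - z) = p y - p z) ->
    (forall z, `|p z| <= normc z) -> cvgn (fun k => p (G k x)).
  move=> pB pn; pose v k := p (G k x).
  have -> : (fun k => p (G k x)) = (fun k => v 0%N + series (telescope v) k).
    by apply/funext => k; rewrite -eq_sum_telescope.
  apply: is_cvgD; first exact: is_cvg_cst.
  apply: normed_cvg; apply: nondecreasing_is_cvgn.
    by apply: nondecreasing_series => k _ _; exact: normr_ge0.
  exists (2 + fine (H x)) => _ [n _ <-]; apply: le_trans (bnd n).
  rewrite /series/=; apply: ler_sum => k _.
  by rewrite /telescope/= /v -pB; exact: pn.
have /cvg_ex[r hr] := cv (@complex.Re R) (raddfB _) (@normr_Re_le R).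
have /cvg_ex[i hi] := cv (@complex.Im R) (raddfB _) (@normr_Im_le R).
by exists (r +i* i).
Qed.

End PaleyWienerProof.

Section PaleyWiener.
Context {R : realType}.
Local Open Scope complex_scope.
Local Notation mu := (@lebesgue_measure R).
Implicit Types (x xi c t : R) (a : int -> R[i]) (n : int) (A : {fset int})
  (f g h : R -> R[i]).

Lemma energy_distC f g : energy (fun x => f x - g x) = energy (fun x => g x - f x).
Proof. by apply: eq_integral => x _; rewrite normc_distC. Qed.

Lemma energy_restrict_le (E : set R) f : measurable E -> cmeas f ->
  (energy (fun x => (\1_E x)%:C * f x)%R <= energy f)%E.
Proof.
move=> mE mf; apply: ge0_le_integral => //.
- by move=> x _; rewrite lee_fin sqr_ge0.
- by apply/measurable_EFinP; apply: measurable_sqr_normc; exact: cmeas_scale.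
- by apply/measurable_EFinP; exact: measurable_sqr_normc.
- move=> x _; rewrite lee_fin normc_scale ler_piMl ?sqr_ge0//.
Qed.

Lemma energy_conull (E : set R) f : measurable E -> {ae mu, forall x, E x} ->
  cmeas f -> energy (fun x => (\1_E x)%:C * f x - f x) = 0%E.
Proof.
move=> mE aeE mf; rewrite -[RHS](@integral0 _ _ R mu setT).
apply: ae_eq_integral => //.
- apply/measurable_EFinP; apply: measurable_sqr_normc; apply: cmeasB => //.
  exact: cmeas_scale.
- move: aeE; apply: (filterS (F := almost_everywhere mu)) => x Ex _.
  by rewrite indicE mem_set// mul1r subrr ComplexField.Normc.normc0 expr0n.
Qed.

Lemma energy_cauchy_le a (A : nat -> {fset int}) (eps : nat -> R) :
  (forall k l, (k <= l)%N -> (A k `<=` A l)%fset) ->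
  (forall k D, [disjoint D & A k]%fset ->
     \sum_(n <- D) normc (a n) ^+ 2 < eps k) ->
  forall k l, (k <= l)%N ->
  (energy (fun x => card_sum a (A l) x - card_sum a (A k) x)%R <= (eps k)%:E)%E /\
  (energy (fun x => card_hat a (A l) x - card_hat a (A k) x)%R <= (eps k)%:E)%E.
Proof.
move=> mono tail k l /mono kl.
have hD : \sum_(n <- (A l `\` A k)%fset) normc (a n) ^+ 2 <= eps k.
  apply: ltW; apply: tail; apply/fdisjointP => n.
  by rewrite inE => /andP[].
split.
  rewrite /energy; under eq_integral do rewrite card_sum_diff//.
  by apply: le_trans (integral_card_sum_le _ _) _; rewrite lee_fin.
rewrite /energy; under eq_integral do rewrite card_hat_diff//.
by rewrite -/(energy (card_hat _ _)) energy_card_hat lee_fin.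
Qed.

Lemma ccvg_scale (r : R) (u : nat -> R[i]) w : ccvg u w ->
  ccvg (fun k => r%:C * u k) (r%:C * w).
Proof.
move=> [h k]; split.
  have e (z : R[i]) : complex.Re (r%:C * z) = r * complex.Re z.
    by case: z => p q /=; rewrite mul0r subr0.
  by under eq_fun do rewrite e; rewrite e; apply: cvgM => //; exact: cvg_cst.
have e (z : R[i]) : complex.Im (r%:C * z) = r * complex.Im z.
  by case: z => p q /=; rewrite mul0r addr0.
by under eq_fun do rewrite e; rewrite e; apply: cvgM => //; exact: cvg_cst.
Qed.

(** The Fourier transform [g] is the almost everywhere limit of the functions
    [card_hat], which vanish off [[-1/2, 1/2]]. To have a limit at every point,
    and thus a measurable one, they are first multiplied by the indicator of the
    set [E] where they converge. *)
Lemma PW_cardinal_series a M : sum_le (fun n => normc (a n) ^+ 2) M ->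
  PW (cardinal_series a).
Proof.
move=> aM; have sq0 n : 0 <= normc (a n) ^+ 2 by rewrite sqr_ge0.
have q0 k : 0 < (4^-1) ^+ k :> R by rewrite exprn_gt0// invr_gt0.
have [A [mono exh tail]] := exhausting_fsets sq0 aM q0.
have hdiff := energy_cauchy_le mono tail.
pose F k := card_sum a (A k); pose G k := card_hat a (A k).
have mF k : cmeas (F k) by apply: ccont_cmeas; exact: ccont_card_sum.
have mG k : cmeas (G k) by exact: cmeas_card_hat.
pose f := cardinal_series a.
have Ff x : ccvg (F^~ x) (f x).
  have [s hs] := cardinal_sums x aM.
  exact: ccvg_sums exh (sums_zsumP hs).
have mf : cmeas f by exact: cmeas_lim mF Ff.
have [E [mE aeE cvE]] := ae_ccvg mG (fun k => (hdiff k k.+1 (leqnSn k)).2).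
pose U k x := (\1_E x)%:C * G k x.
have mU k : cmeas (U k) by exact: cmeas_scale.
have /choice[g Ug] x : exists w, ccvg (U^~ x) w.
  have [Ex|nEx] := pselect (E x).
    by have [w hw] := cvE x Ex; exists ((\1_E x)%:C * w); exact: ccvg_scale.
  exists 0; rewrite (_ : U^~ x = fun=> 0); first by split; exact: cvg_cst.
  by apply/funext => k; rewrite /U indicE memNset// mul0r.
have mg : cmeas g by exact: cmeas_lim mU Ug.
have m0 : cmeas (fun=> 0 : R[i]) by split; exact: measurable_cst.
have e0 h : energy (fun x => h x - 0) = energy h.
  by apply: eq_integral => x _; rewrite subr0.
have fin_f : (energy f < +oo)%E.
  rewrite -e0; apply: (@le_lt_trans _ _ M%:E); last exact: ltry.
  apply: (energy_fatou (K := 0%N) mF m0 Ff) => k _; rewrite e0.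
  by apply: le_trans (integral_card_sum_le _ _) _; rewrite lee_fin.
have fin_g : (energy g < +oo)%E.
  rewrite -e0; apply: (@le_lt_trans _ _ M%:E); last exact: ltry.
  apply: (energy_fatou (K := 0%N) mU m0 Ug) => k _; rewrite e0.
  apply: le_trans (energy_restrict_le mE (mG k)) _.
  by rewrite energy_card_hat lee_fin.
exists g; last first.
  apply: aeW => xi /negP out.
  have U0 : U^~ xi = fun=> 0.
    apply/funext => k; rewrite /U /G /card_hat boxE (negbTE out).
    by rewrite mul0r mulr0.
  have := Ug xi; rewrite U0 => -[/cvg_lim hr /cvg_lim hi].
  have := hr (@Rhausdorff R); have := hi (@Rhausdorff R).
  rewrite !lim_cst; last exact: Rhausdorff.
  by case: (g xi) => p q /= <- <-.
split; [exact: energy_cLp2|exact: energy_cLp2|] => eps eps0.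
pose e := eps ^+ 2; have ep : 0 < e by rewrite exprn_gt0.
have [l hl] : exists l, (4^-1) ^+ l < e / 16 :> R.
  have [l hl] : exists l : nat, 16 / e < l%:R.
    by exists (Num.bound (16 / e)); apply: archi_boundP; rewrite divr_ge0// ltW.
  exists l; rewrite exprVn invf_plt ?posrE ?exprn_gt0 ?divr_gt0// invf_div.
  by apply: lt_le_trans hl _; rewrite -natrX ler_nat ltnW// ltn_expl.
(* [energy_triangle] costs a factor 2: the errors [e / 16] grow to [e / 4] on the way
   from [f] to [h] through [F l], and to [e / 2] on the way from [g] to
   [fourier h] through [U l] and [G l] *)
have e16 : 0 < e / 16 by rewrite divr_gt0.
have [h [h1 mh mhh hF hG]] := card_sum_approx a (A l) e16.
have fF : (energy (fun x => f x - F l x)%R <= (e / 16)%:E)%E.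
  apply: (energy_fatou (K := l) mF (mF l) Ff) => k lk.
  by apply: le_trans (hdiff l k lk).1 _; rewrite lee_fin ltW.
have gU : (energy (fun x => g x - U l x)%R <= (e / 16)%:E)%E.
  apply: (energy_fatou (K := l) mU (mU l) Ug) => k lk.
  have -> : energy (fun x => U k x - U l x) =
      energy (fun x => (\1_E x)%:C * (G k x - G l x)).
    by apply: eq_integral => x _; rewrite /U mulrBr.
  apply: le_trans (energy_restrict_le mE (cmeasB (mG k) (mG l))) _.
  by apply: le_trans (hdiff l k lk).2 _; rewrite lee_fin ltW.
have gG : (energy (fun x => g x - G l x)%R <= (e / 8)%:E)%E.
  apply: le_trans (energy_triangle mg (mU l) (mG l)) _.
  rewrite (energy_conull mE aeE (mG l)) mule0 adde0.
  apply: le_trans (lee_wpmul2l _ gU) _ => //.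
  by rewrite -EFinM lee_fin; lra.
have two (x y : \bar R) (p q r : R) : (x <= p%:E)%E -> (y < q%:E)%E -> 2 * p + 2 * q <= r ->
    (2%:E * x + 2%:E * y <= r%:E)%E.
  move=> xp yq pqr; apply: (@le_trans _ _ ((2 * p + 2 * q)%:E)); last by rewrite lee_fin.
  by rewrite (EFinD (2 * p)) (EFinM 2 p) (EFinM 2 q) leeD// lee_wpmul2l// ltW.
exists h; split => //.
- apply: energy_cLp2 => //; rewrite -e0.
  apply: le_lt_trans (energy_triangle mh (mF l) m0) _.
  rewrite e0 energy_distC.
  apply: (@le_lt_trans _ _ (2%:E * (e / 16)%:E + 2%:E * M%:E)%E).
    apply: leeD; apply: lee_wpmul2l => //; first exact: ltW.
    by apply: le_trans (integral_card_sum_le _ _) _; rewrite lee_fin.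
  by rewrite -!EFinM -EFinD ltry.
- apply: cdist2_lt => //; apply: le_lt_trans (energy_triangle mf (mF l) mh) _.
  apply: (@le_lt_trans _ _ (e / 4)%:E); last by rewrite lte_fin -/e; lra.
  by apply: two fF hF _; lra.
- apply: cdist2_lt => //; apply: le_lt_trans (energy_triangle mg (mG l) mhh) _.
  apply: (@le_lt_trans _ _ (e / 2)%:E); last by rewrite lte_fin -/e; lra.
  by apply: two gG hG _; lra.
Qed.

End PaleyWiener.

Theorem theorem1p2 (R : realType) (a : int -> R[i]) (ha : ell2 a) :
  (* the series defining f and the b_k converge, and f is in PW_pi *)
  [/\ forall x : R, has_zsum (cardinal_term a x) (cardinal_series a x),
      forall k : int, has_zsum (b_term a k) (b_coef a k) &
      PW (cardinal_series a)] /\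
  (* the interpolation formula, and its uniform convergence on compact sets *)
  (forall x : R, cardinal_series a x = zsum (fun k => interp_term a k x)) /\
  (forall K : set R, compact K ->
     {uniform K, interp_partial_sum a @ summability.totally
        --> (cardinal_series a : R -> R[i]^o)}).
Proof.
have [M aM] := ell2_sum_le ha.
split; first split.
- by move=> x; have [s hs] := cardinal_sums x aM; apply/has_zsumP; exact: sums_zsumP hs.
- by move=> k; have [s hs] := b_term_sums k aM; apply/has_zsumP; exact: sums_zsumP hs.
- exact: PW_cardinal_series aM.
split.
- by move=> x; rewrite (sums_zsum (interp_sums x aM)).
- by move=> K; exact: interp_uniform aM.
Qed.
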